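(* For every $k\ge 2$, $\mathbf{FACTOR}_k^{\mathrm{cherry},1}=\mathbf{COVER}_k^{\mathrm{cherry},1}$.
   Context: A $k$-graph $H$ has edge set $E(H)\subseteq\binom{V(H)}{k}$; $\delta_1(H)$ is the minimum number of edges containing a vertex. An $F$-factor is a set of vertex-disjoint copies of $F$ covering all vertices. An $(n,p,\mu,\mathrm{cherry})$ $k$-graph is a $k$-graph $H$ on a vertex set $V$ with $|V|=n$ such that for all $P,Q\subseteq V^{k-1}$, writing $\mathcal{K}(P,Q)=\{(x_1,\dots,x_k)\in V^k:(x_1,\dots,x_{k-1})\in P,\ (x_2,\dots,x_k)\in Q\}$ and $e(P,Q)=|\{(x_1,\dots,x_k)\in\mathcal{K}(P,Q):\{x_1,\dots,x_k\}\in E(H)\}|$, we have $e(P,Q)\ge p|\mathcal{K}(P,Q)|-\mu n^k$. $\mathbf{FACTOR}_k^{\mathrm{cherry},1}$ is the class of $k$-graphs $F$ such that for all $0<p,\alpha<1$ there exist $n_0$ and $\mu>0$ such that every $(n,p,\mu,\mathrm{cherry})$ $k$-graph $H$ with $\delta_1(H)\ge\alpha n^{k-1}$, $n\ge n_0$ and $v(F)\mid n$ has an $F$-factor. $\mathbf{COVER}_k^{\mathrm{cherry},1}$ is the class of $k$-graphs $F$ such that for all $0<p,\alpha<1$ there exist $n_0$ and $\mu>0$ such that in every $(n,p,\mu,\mathrm{cherry})$ $k$-graph $H$ with $\delta_1(H)\ge\alpha n^{k-1}$ and $n\ge n_0$ every vertex lies in a copy of $F$. *)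

(* Defs.v *)
From HB Require Import structures.
From mathcomp Require Import all_boot all_order all_algebra.
From mathcomp Require Import reals.
Set Implicit Arguments. Unset Strict Implicit. Unset Printing Implicit Defensive.
Import Order.TTheory GRing.Theory Num.Theory.
Local Open Scope ring_scope.

Definition is_kgraph (k : nat) (V : finType) (E : {set {set V}}) : bool :=
  [forall e in E, #|e| == k]%N.

Definition embedding (W V : finType) (EF : {set {set W}}) (E : {set {set V}})
  (f : W -> V) : Prop :=
  injective f /\ (forall e, e \in EF -> f @: e \in E).

Definition copy_on (W V : finType) (EF : {set {set W}}) (E : {set {set V}})
  (S : {set V}) : Prop :=
  exists f : W -> V, embedding EF E f /\ S = f @: [set: W].

Definition has_factor (W V : finType) (EF : {set {set W}}) (E : {set {set V}})
  : Prop :=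
  exists Pt : {set {set V}}, partition Pt [set: V] /\
    (forall S, S \in Pt -> copy_on EF E S).

Definition covers (W V : finType) (EF : {set {set W}}) (E : {set {set V}})
  : Prop :=
  forall v : V, exists S, copy_on EF E S /\ v \in S.

Definition deg1 (V : finType) (E : {set {set V}}) (v : V) : nat :=
  #|[set e in E | v \in e]|.

Definition cherryK (k : nat) (V : finType) (P Q : {set (k.-1).-tuple V})
  : {set k.-tuple V} :=
  [set x : k.-tuple V |
     [exists t in P, val t == take k.-1 x] &&
     [exists t in Q, val t == behead x]].

Definition cherry_e (k : nat) (V : finType) (E : {set {set V}})
  (P Q : {set (k.-1).-tuple V}) : nat :=
  #|[set x in cherryK P Q | [set z | z \in x] \in E]|.

Definition cherry_graph (R : realType) (k : nat) (V : finType)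
  (E : {set {set V}}) (p mu : R) : Prop :=
  forall P Q : {set (k.-1).-tuple V},
    p * (#|cherryK P Q|)%:R - mu * (#|V|%:R) ^+ k <= (cherry_e E P Q)%:R.

Definition FACTOR_cherry1 (R : realType) (k : nat) (W : finType)
  (EF : {set {set W}}) : Prop :=
  forall p alpha : R, 0 < p < 1 -> 0 < alpha < 1 ->
  exists (n0 : nat) (mu : R), 0 < mu /\
    forall (V : finType) (E : {set {set V}}),
      is_kgraph k E -> cherry_graph k E p mu ->
      (forall v : V, alpha * (#|V|%:R) ^+ k.-1 <= (deg1 E v)%:R) ->
      (n0 <= #|V|)%N -> (#|W| %| #|V|)%N ->
      has_factor EF E.

Definition COVER_cherry1 (R : realType) (k : nat) (W : finType)
  (EF : {set {set W}}) : Prop :=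
  forall p alpha : R, 0 < p < 1 -> 0 < alpha < 1 ->
  exists (n0 : nat) (mu : R), 0 < mu /\
    forall (V : finType) (E : {set {set V}}),
      is_kgraph k E -> cherry_graph k E p mu ->
      (forall v : V, alpha * (#|V|%:R) ^+ k.-1 <= (deg1 E v)%:R) ->
      (n0 <= #|V|)%N ->
      covers EF E.

(* Main.v *)
Require Import Defs.
From HB Require Import structures.
From mathcomp Require Import all_boot all_order all_algebra.
From mathcomp Require Import reals.
From mathcomp Require Import zify ring lra.
Set Implicit Arguments. Unset Strict Implicit. Unset Printing Implicit Defensive.
Import Order.TTheory GRing.Theory Num.Theory.

(** Testing the cherry condition on (vertex) x ((k-1)-set) pairs shows that for every
    dense family Q of (k-1)-sets all but few vertices w satisfy w |: e \in E for at
    least p/2 of the e in Q.  Hence, for F in COVER, a new vertex with a prescribed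
    dense link can be glued to an almost arbitrary vertex subset, so that a single set T
    completes every vertex whose link contains the prescribed one to a copy of F.

    Consequently any two vertices u, v can be exchanged robustly: a typical w shares a
    positive proportion of its link with u and with v.  Exchanges give bounded-size
    absorbers for any given bounded set, and chaining these along a linear-size set X of
    ports, with f-1 carry vertices between consecutive absorbers, gives a structure that
    can be tiled whichever part of X is left over, subject to divisibility only.  Every
    linear-size X serves as a reservoir for all but few vertices; the exceptional ones
    are covered first, the rest is tiled greedily, and the remaining vertices are covered
    using X.

    Conversely, for F in FACTOR and a vertex v, deleting fewer than v(F) other vertices
    makes the order divisible and preserves the hypotheses up to constants. *)

(** * Tilings and absorption *)

(** Set identities, inclusions and disjointness are decided pointwise: the hypotheses are
    specialised at one generic point, and membership in each set is split into cases. *)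
Ltac set_tac :=
  let x := fresh "x" in
  match goal with
  | |- is_true (_ \subset _) => apply/subsetP => x; apply/implyP
  | |- is_true [disjoint _ & _] => rewrite disjoints_subset; apply/subsetP => x; apply/implyP
  | |- _ = _ => apply/setP => x; apply/eqP
  end;
  repeat match goal with
  | H : is_true (_ \subset _) |- _ => move/subsetP/(_ x)/implyP: H; apply/implyP
  | H : is_true [disjoint _ & _] |- _ =>
      rewrite disjoints_subset in H; move/subsetP/(_ x)/implyP: H; apply/implyP
  end;
  rewrite ?inE;
  repeat match goal with
  | |- context [x \in ?A] => case: (x \in A) => //=
  | |- context [x == ?y] => case: (x == y) => //=
  end.

Lemma cardU_disjoint (T : finType) (A B : {set T}) :
  [disjoint A & B] -> #|A :|: B| = #|A| + #|B|.
Proof. by rewrite cardsU -setI_eq0 => /eqP ->; rewrite cards0 subn0. Qed.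

Lemma leq_cardU (T : finType) (A B : {set T}) : #|A :|: B| <= #|A| + #|B|.
Proof. by rewrite leq_card_setU. Qed.

Lemma leq_cardU1 (T : finType) (x : T) (A : {set T}) : #|x |: A| <= #|A|.+1.
Proof. by rewrite cardsU1; case: (x \notin A). Qed.

Lemma disjointsU (T : finType) (A B C : {set T}) :
  [disjoint A & C] -> [disjoint B & C] -> [disjoint A :|: B & C].
Proof. by move=> dAC dBC; set_tac. Qed.

Lemma disjoints1 (T : finType) (x : T) (A : {set T}) :
  [disjoint [set x] & A] = (x \notin A).
Proof. by rewrite disjoints_subset sub1set inE. Qed.

Lemma subset_of_card (T : finType) (A : {set T}) m :
  m <= #|A| -> exists2 B : {set T}, B \subset A & #|B| = m.
Proof.
move=> le_mA; have /card_gt0P[B] : 0 < #|[set B : {set T} | B \subset A & #|B| == m]|.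
  by rewrite cards_draws bin_gt0.
by rewrite inE => /andP[sBA /eqP]; exists B.
Qed.

(** Room that suffices for absorbing one set of at most [2 * f] vertices, at [2 * f + 4] per
    vertex. *)
Definition absorber_size (f : nat) : nat := 2 * f * (2 * f + 4).

(** One absorber for each subset of a set of at most [2 * f] vertices. *)
Definition gadget_size (f : nat) : nat := 2 ^ (2 * f) * absorber_size f.

Section Tilings.

Variables (W V : finType) (EF : {set {set W}}) (E : {set {set V}}).
Local Notation f := #|W|.
Hypothesis f_gt0 : 0 < f.

(** This is [has_factor] relativised to a vertex set; at [[set: V]] the two agree. *)
Definition tiled (X : {set V}) : Prop :=
  exists Pt : {set {set V}}, partition Pt X /\
    (forall S, S \in Pt -> copy_on EF E S).

Lemma copy_card S : copy_on EF E S -> #|S| = f.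
Proof. by case=> g [[g_inj _] ->]; rewrite card_imset // cardsT. Qed.

Lemma tiled0 : tiled set0.
Proof. by exists set0; split=> [|S]; rewrite ?partition_set0 ?inE. Qed.

Lemma tiled_copy S : copy_on EF E S -> tiled S.
Proof.
move=> cS; exists [set S]; split=> [|T /set1P -> //].
rewrite /partition /cover big_set1 eqxx /= inE eq_sym -card_gt0 (copy_card cS) f_gt0 andbT.
by apply/trivIsetP => A B /set1P -> /set1P ->; rewrite eqxx.
Qed.

Lemma tiledU (X Y : {set V}) : [disjoint X & Y] -> tiled X -> tiled Y -> tiled (X :|: Y).
Proof.
move=> dXY [P [pP cP]] [Q [pQ cQ]]; exists (P :|: Q); split; last first.
  by move=> S /setUP[/cP|/cQ].
have sub0 S T : S \in P -> T \in Q -> [disjoint S & T].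
  move=> /(partitionS pP) sSX /(partitionS pQ) sTY; set_tac.
have tP := trivIsetP (partition_trivIset pP).
have tQ := trivIsetP (partition_trivIset pQ).
apply/and3P; split; last by rewrite inE (partition0 pP) (partition0 pQ).
  by rewrite /cover bigcup_setU -!/(cover _) (cover_partition pP) (cover_partition pQ).
apply/trivIsetP => A B /setUP[] AP /setUP[] BP; first exact: tP.
- by move=> _; apply: sub0.
- by move=> _; rewrite disjoint_sym; apply: sub0.
- exact: tQ.
Qed.

Lemma tiled_dvd (X : {set V}) : tiled X -> f %| #|X|.
Proof.
case=> P [pP cP]; rewrite (card_uniform_partition (n := f) _ pP) ?dvdn_mull //.
by move=> S /cP /copy_card.
Qed.


(** * Absorption, given covering and exchanging outside any [m] forbidden vertices *)

Section Absorption.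

Variable m : nat.
Hypothesis lt_mV : m < #|V|.
Hypothesis cover_avoid : forall v (U : {set V}), #|U| <= m -> v \notin U ->
  exists2 T : {set V}, [disjoint T & v |: U] & copy_on EF E (v |: T).
Hypothesis connect_avoid : forall u v (U : {set V}), u != v -> #|U| <= m ->
  exists T : {set V}, [/\ #|T| <= 2 * f, [disjoint T & u |: (v |: U)],
    tiled (u |: T) & tiled (v |: T)].

(** Greedy choice: as [m < #|V|], some vertex is neither forbidden nor used, and [cover_avoid] puts
    it in a new copy. *)
Lemma tiled_avoid j (U : {set V}) : #|U| + j * f <= m ->
  exists C : {set V}, [/\ #|C| = j * f, [disjoint C & U] & tiled C].
Proof.
elim: j => [|j IH] leUm.
  by exists set0; rewrite cards0; split=> //; [set_tac | apply: tiled0].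
have [C [cC dC tC]] : exists C : {set V}, [/\ #|C| = j * f, [disjoint C & U] & tiled C].
  by apply: IH; lia.
have leUC := leq_cardU U C.
have /card_gt0P[v] : 0 < #|~: (U :|: C)| by have := cardsC (U :|: C); lia.
rewrite inE => vUC.
have [|T dT cT] := @cover_avoid v (U :|: C) _ vUC; first by lia.
have dvT : [disjoint v |: T & C].
  move: vUC; rewrite inE negb_or => /andP[_ vC].
  rewrite disjointsU // ?disjoints1 //; set_tac.
exists ((v |: T) :|: C); split; last exact: tiledU dvT (tiled_copy cT) tC.
  by rewrite (cardU_disjoint dvT) (copy_card cT) cC mulSn.
move: vUC; rewrite inE negb_or => /andP[vU _].
rewrite !disjointsU ?disjoints1 //; set_tac.
Qed.

(** The vertices of [S] and [C] are paired, and each pair gets its own connector, disjoint from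
    everything else. The term [2 * f + 2] counts a connector and its pair. *)
Lemma exchange j (S C U : {set V}) : #|S| = j -> #|C| = j -> [disjoint S & C] ->
  #|U| + j * (2 * f + 2) <= m ->
  exists T : {set V}, [/\ #|T| <= j * (2 * f), [disjoint T & S :|: C :|: U],
    tiled (S :|: T) & tiled (C :|: T)].
Proof.
elim: j S C U => [|j IH] S C U cS cC dSC leUm.
  exists set0; rewrite (cards0_eq cS) (cards0_eq cC) setU0 cards0.
  by split=> //; [set_tac | apply: tiled0 | apply: tiled0].
have [/card_gt0P[s sS] /card_gt0P[c cC']] : 0 < #|S| /\ 0 < #|C| by lia.
have cS0 := cardsD1 s S; have cC0 := cardsD1 c C.
have neq_sc : s != c.
  by apply: contraTneq dSC => eq_sc; apply/pred0Pn; exists s; rewrite /= sS eq_sc.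
have sc : s |: (c |: U) = [set s; c] :|: U by set_tac.
have [T0 [cT0 dT0 tS0 tC0]] : exists T : {set V}, [/\ #|T| <= j * (2 * f),
    [disjoint T & (S :\ s) :|: (C :\ c) :|: (s |: (c |: U))],
    tiled ((S :\ s) :|: T) & tiled ((C :\ c) :|: T)].
  apply: IH; [by lia | by lia | | ].
    by set_tac.
  by rewrite sc; have := leq_cardU [set s; c] U; rewrite cards2; lia.
have [T1 [cT1 dT1 tS1 tC1]] : exists T : {set V}, [/\ #|T| <= 2 * f,
    [disjoint T & s |: (c |: (U :|: (S :|: C) :|: T0))], tiled (s |: T) & tiled (c |: T)].
  apply: connect_avoid => //.
  have := leq_cardU (U :|: (S :|: C)) T0; have := leq_cardU U (S :|: C).
  have := leq_cardU S C; lia.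
have [sS' cC''] : [set s] \subset S /\ [set c] \subset C by rewrite !sub1set.
exists (T0 :|: T1); split.
- by have := leq_cardU T0 T1; lia.
- rewrite disjointsU //.
    rewrite disjoints_subset; apply/subsetP => x xT; move: dT0.
    rewrite disjoints_subset => /subsetP/(_ x xT).
    rewrite !inE; case: (x == s) => //=; case: (x == c) => //=; rewrite ?orbT //.
  by set_tac.
- have -> : S :|: (T0 :|: T1) = (s |: T1) :|: ((S :\ s) :|: T0).
    by apply/setP => x; rewrite !inE; case: (eqVneq x s) => [->|_]; rewrite ?sS //=;
      do ?case: (x \in _).
  apply: tiledU => //; rewrite disjointsU //; last by set_tac.
  rewrite disjoints1 !inE eqxx /=.
  apply: contraL dT0 => sT0; apply/pred0Pn; exists s => /=; rewrite sT0 !inE eqxx ?orbT //.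
- have -> : C :|: (T0 :|: T1) = (c |: T1) :|: ((C :\ c) :|: T0).
    by apply/setP => x; rewrite !inE; case: (eqVneq x c) => [->|_]; rewrite ?cC' //=;
      do ?case: (x \in _).
  apply: tiledU => //; rewrite disjointsU //; last by set_tac.
  rewrite disjoints1 !inE eqxx /=.
  apply: contraL dT0 => sT0; apply/pred0Pn; exists c => /=; rewrite sT0 !inE eqxx ?orbT //.
Qed.

(** Let [C] be a union of disjoint copies with [#|C| = #|J|], and let [T] exchange [J] with [C]. In
    [A = C :|: T], the set [T] is tiled with [C] if [J] is absent; if [J] is present, [T] is tiled
    with [J] and [C] by its own copies. *)
Lemma absorber (J U : {set V}) : f %| #|J| -> #|U| + #|J| * (2 * f + 4) <= m ->
  exists A : {set V}, [/\ #|A| <= #|J| * (2 * f + 1), [disjoint A & J :|: U],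
    tiled A & tiled (A :|: J)].
Proof.
move=> /dvdnP[j cJ] leUm.
have leJU := leq_cardU J U.
have [|C [cC dC tC]] := @tiled_avoid j (J :|: U); first by lia.
have dJC : [disjoint J & C] by set_tac.
have [||T [cT dT tJT tCT]] := @exchange #|J| J C U erefl _ dJC; [by lia | by lia |].
exists (C :|: T); split=> //.
- by have := leq_cardU C T; lia.
- by set_tac.
- have -> : C :|: T :|: J = C :|: (J :|: T) by set_tac.
  by apply: tiledU => //; set_tac.
Qed.

(** Disjoint absorbers are built, one for each member of [Js]. To absorb [J], its own absorber takes
    it in while all the others are tiled alone. *)
Lemma absorber_family (O U : {set V}) (b : nat) (Js : seq {set V}) :
  {in Js, forall J : {set V}, J \subset O /\ f %| #|J|} ->
  #|O| * (2 * f + 4) <= b -> #|U| + #|O| + (size Js + 1) * b <= m ->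
  exists A : {set V}, [/\ #|A| <= size Js * b, [disjoint A & O :|: U],
    tiled A & {in Js, forall J : {set V}, tiled (A :|: J)}].
Proof.
move=> + leOb; elim: Js U => [|J Js IH] U JsO leUm.
  by exists set0; rewrite cards0; split=> //; [set_tac | apply: tiled0].
have [sJO fJ] := JsO J (mem_head _ _).
have leJO := subset_leq_card sJO.
have leUO := leq_cardU U O.
have leJb : #|J| * (2 * f + 4) <= b by rewrite (leq_trans _ leOb) // leq_mul2r leJO orbT.
have [|A1 [cA1 dA1 tA1 tA1J]] := @absorber J (U :|: O) fJ.
  by move: leUm leUO leJb => /=; clear; lia.
have {}cA1 : #|A1| <= b by lia.
have leUA := leq_cardU U A1.
have [| |A2 [cA2 dA2 tA2 tA2J]] := IH (U :|: A1).
- by move=> J' J'Js; apply: JsO; rewrite inE J'Js orbT.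
- by move: leUm => /=; lia.
exists (A1 :|: A2); split.
- by have := leq_cardU A1 A2; move=> /=; lia.
- by set_tac.
- by apply: tiledU => //; set_tac.
- move=> J'; rewrite inE => /orP[/eqP -> | J'Js].
    have -> : A1 :|: A2 :|: J = (A1 :|: J) :|: A2 by set_tac.
    by apply: tiledU => //; set_tac.
  have [sJ'O _] : J' \subset O /\ f %| #|J'| by apply: JsO; rewrite inE J'Js orbT.
  have -> : A1 :|: A2 :|: J' = A1 :|: (A2 :|: J') by set_tac.
  by apply: tiledU => //; [set_tac | apply: tA2J].
Qed.

Local Notation b := (absorber_size f).
Local Notation g := (gadget_size f).

Lemma flexible_absorber (O U : {set V}) : #|O| <= 2 * f ->
  #|U| + 2 * f + g + b <= m ->
  exists A : {set V}, [/\ #|A| <= g, [disjoint A & O :|: U] &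
    forall J : {set V}, J \subset O -> f %| #|J| -> tiled (A :|: J)].
Proof.
move=> leO leUm.
pose Js := enum [set J in powerset O | f %| #|J|].
have szJs : size Js <= 2 ^ (2 * f).
  rewrite -cardE (leq_trans (subset_leq_card (_ : _ \subset powerset O))) //.
    by apply/subsetP => J; rewrite inE => /andP[].
  by rewrite card_powerset leq_exp2l.
have leJb : size Js * b <= g by rewrite /gadget_size leq_mul2r szJs orbT.
have [| | |A [cA dA _ tA]] := @absorber_family O U b Js.
- by move=> J; rewrite mem_enum !inE => /andP[].
- by rewrite /absorber_size leq_mul2r leO orbT.
- by move: leUm leO leJb; move: (size Js) => sz; clear; lia.
exists A; split=> // [|J sJO fJ]; first exact: leq_trans leJb.
by apply: tA; rewrite mem_enum !inE sJO.
Qed.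

(* The vertices of [C] carry the residue modulo [f] of the used part of the
   ports from one absorber of the chain to the next one. *)
Lemma absorbing_chain (N : nat) (X U : {set V}) : #|X| = N ->
  #|U| + N.+1 * (2 * g + 4 * f + 2) <= m ->
  exists Y C : {set V}, [/\ #|C| = f.-1, #|Y| <= N * (g + f),
    [disjoint Y & C], [disjoint Y :|: C & X :|: U] &
    forall X' : {set V}, X' \subset X ->
      exists2 C' : {set V}, C' \subset C & tiled (Y :|: X' :|: C')].
Proof.
have b_le_g : b <= g by rewrite /gadget_size leq_pmull // expn_gt0.
elim: N X U => [|N IH] X U cX leUm.
  have [|C sC cC] := @subset_of_card _ (~: U) f.-1; first by have := cardsC U; lia.
  exists set0, C; split; rewrite ?cards0 //.
  - by set_tac.
  - by rewrite (cards0_eq cX); set_tac.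
  - move=> X'; rewrite (cards0_eq cX) subset0 => /eqP ->; exists set0; first exact: sub0set.
    by rewrite !setU0; apply: tiled0.
have /card_gt0P[p pX] : 0 < #|X| by lia.
have cX0 := cardsD1 p X; rewrite pX in cX0.
have leUp := leq_cardU [set p] U; rewrite cards1 in leUp.
have [||Y [C [cC cY dYC dX tX]]] := IH (X :\ p) (p |: U); [by lia | by lia |].
pose U1 := U :|: X :|: Y :|: C.
have cU1 : #|U1| <= #|U| + N.+1 + N * (g + f) + f.
  rewrite /U1; have := leq_cardU (U :|: X :|: Y) C.
  have := leq_cardU (U :|: X) Y; have := leq_cardU U X; lia.
have [|C1 sC1 cC1] := @subset_of_card _ (~: U1) f.-1; first by have := cardsC U1; lia.
(* The new gadget can absorb the port [p], the incoming carry [C] and the outgoing carry [C1], in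
   any combination of size divisible by [f]. *)
pose O := p |: (C :|: C1).
have cO : #|O| <= 2 * f.
  have := leq_cardU [set p] (C :|: C1); have := leq_cardU C C1.
  rewrite cards1 /O; lia.
have [|A [cA dA tA]] := @flexible_absorber O (U :|: X :|: Y) cO.
  have := leq_cardU (U :|: X) Y; have := leq_cardU U X; lia.
have sp : [set p] \subset X by rewrite sub1set.
have pC : p \notin Y :|: C.
  by apply: contraL dX => pYC; apply/pred0Pn; exists p; rewrite /= pYC !inE eqxx orbT.
have {}dX : [disjoint Y :|: C & X :|: U].
  by move: dX; rewrite setUA [X :\ p :|: _]setUC setD1K.
rewrite /U1 in sC1; rewrite /O in dA tA cO.
exists (Y :|: C :|: A), C1; split=> //.
- have := leq_cardU (Y :|: C) A; have := leq_cardU Y C; lia.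
- by set_tac.
- by set_tac.
move=> X' sX'.
have [C' sC' tC'] := tX (X' :\ p) (setSD _ sX').
pose J0 := (C :\: C') :|: (X' :&: [set p]).
have [C2 sC2 cC2] : exists2 C2 : {set V}, C2 \subset C1 & #|C2| = (f - #|J0| %% f) %% f.
  by apply: subset_of_card; rewrite cC1 -ltnS prednK // ltn_pmod.
have dJ0 : [disjoint J0 & C2] by rewrite /J0; set_tac.
exists C2 => //.
have -> : Y :|: C :|: A :|: X' :|: C2 = (Y :|: X' :\ p :|: C') :|: (A :|: (J0 :|: C2)).
  apply/setP => x; rewrite !inE; move/subsetP/(_ x): sC'.
  case: (x == p); case: (x \in Y); case: (x \in C); case: (x \in C'); case: (x \in A) => //=;
  by case: (x \in X'); case: (x \in C2) => //= /(_ isT).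
apply: tiledU => //.
- have sX'' : X' :\ p \subset X :\: [set p] by apply: setSD.
  have {}pC : [disjoint [set p] & Y :|: C] by rewrite disjoints1.
  rewrite /J0; set_tac.
- apply: tA; first by rewrite /J0; set_tac.
  rewrite cardU_disjoint // cC2 /dvdn.
  rewrite modnDmr -modnDml subnKC ?modnn //.
  exact/ltnW/ltn_pmod.
Qed.

(** * Exceptional vertices, greedy tiling and the reservoir *)

Lemma cover_set (D U : {set V}) : [disjoint D & U] -> #|U| + f * #|D| <= m ->
  exists G : {set V}, [/\ D \subset G, [disjoint G & U], #|G| <= f * #|D| & tiled G].
Proof.
move: {2}#|D| (erefl #|D|) => j; elim: j D => [|j IH] D cD dDU leUm.
  exists set0; rewrite (cards0_eq cD) cards0; split=> //; [by set_tac | exact: tiled0].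
have /card_gt0P[v vD] : 0 < #|D| by lia.
have cD0 := cardsD1 v D; rewrite vD in cD0.
have [| | |G [sG dG cG tG]] := IH (D :\ v); [by lia | by set_tac | by lia |].
have vU : v \notin U by rewrite (disjointFr dDU).
have [vG | vG] := boolP (v \in G).
  exists G; split=> //; last by lia.
  by rewrite -(setD1K vD) subUset sub1set vG.
have leUG := leq_cardU U G.
have [| |T dT cT] := @cover_avoid v (U :|: G); [by lia | by rewrite inE negb_or vU |].
have dvTG : [disjoint v |: T & G] by rewrite disjointsU ?disjoints1 //; set_tac.
exists ((v |: T) :|: G); split.
- by rewrite -(setD1K vD) subUset !sub1set !inE eqxx /=; set_tac.
- by rewrite !disjointsU ?disjoints1 //; set_tac.
- by rewrite (cardU_disjoint dvTG) (copy_card cT); lia.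
- exact: tiledU dvTG (tiled_copy cT) tG.
Qed.

Lemma greedy_tiling (l : nat) (S : {set V}) :
  (forall S' : {set V}, l < #|S'| -> exists2 T : {set V}, T \subset S' & copy_on EF E T) ->
  exists G : {set V}, [/\ G \subset S, tiled G & #|S :\: G| <= l].
Proof.
move=> dense; move: {2}#|S|.+1 (ltnSn #|S|) => j; elim: j S => // j IH S cS.
have [leSl | /dense[T sTS cT]] := leqP #|S| l.
  by exists set0; rewrite setD0 sub0set; split=> //; apply: tiled0.
have [|G [sG tG cG]] := IH (S :\: T).
  have := subset_leq_card sTS.
  by rewrite cardsD (setIidPr sTS) (copy_card cT); move: cS f_gt0; clear; lia.
exists (T :|: G); split; first by set_tac.
  by apply: tiledU => //; [set_tac | apply: tiled_copy].
by rewrite setDDl in cG.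
Qed.

(** The vertices of [L] are covered one by one, each copy taking its other [f - 1] vertices from
    [X]. The set [Z] records the spent part of [X], which never exceeds [q]. *)
Lemma tiled_by_reservoir (q : nat) (X D L : {set V}) :
  (forall v (Z : {set V}), v \notin X -> v \notin D -> Z \subset X -> #|Z| <= q ->
    exists2 T : {set V}, T \subset X :\: Z & copy_on EF E (v |: T)) ->
  [disjoint L & X] -> [disjoint L & D] -> f * #|L| <= q ->
  exists2 Z : {set V}, Z \subset X & tiled (L :|: Z) /\ #|Z| <= f * #|L|.
Proof.
move=> res; move: {2}#|L| (erefl #|L|) => j; elim: j L => [|j IH] L cL dLX dLD leLq.
  exists set0; first exact: sub0set.
  by rewrite (cards0_eq cL) setU0 cards0; split=> //; apply: tiled0.
have /card_gt0P[v vL] : 0 < #|L| by lia.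
have cL0 := cardsD1 v L; rewrite vL in cL0.
have [||||Z sZ [tZ cZ]] := IH (L :\ v); [by lia | by set_tac | by set_tac | by lia |].
have [vX vD] : v \notin X /\ v \notin D by rewrite (disjointFr dLX) ?(disjointFr dLD).
have [|T sT cT] := res v Z vX vD sZ; first by lia.
exists (T :|: Z); first by set_tac.
have cardT : #|T| < f.
  rewrite -(copy_card cT) cardsU1; suff -> : v \notin T by [].
  by apply: contra vX => /(subsetP sT); rewrite inE => /andP[].
split; last by have := leq_cardU T Z; lia.
have -> : L :|: (T :|: Z) = (v |: T) :|: (L :\ v :|: Z).
  by apply/setP => x; rewrite !inE; case: (eqVneq x v) => [->|_]; rewrite ?vL //=;
    do ?case: (x \in _).
apply: tiledU => //; last exact: tiled_copy.
rewrite disjointsU //; last by set_tac.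
by rewrite disjoints1 !inE eqxx /=; apply: contra vX => /(subsetP sZ).
Qed.

Lemma tiled_of_reservoir (q l : nat) (X D : {set V}) :
  (forall S' : {set V}, l < #|S'| -> exists2 T : {set V}, T \subset S' & copy_on EF E T) ->
  (forall v (Z : {set V}), v \notin X -> v \notin D -> Z \subset X -> #|Z| <= q ->
    exists2 T : {set V}, T \subset X :\: Z & copy_on EF E (v |: T)) ->
  #|X|.+1 * (2 * g + 4 * f + 2) + f * #|D| <= m -> f * l <= q -> f %| #|V| ->
  tiled [set: V].
Proof.
move=> dense res le_m leq_lq fV.
have [|Y [C [cC cY dYC dYCX chain]]] := @absorbing_chain #|X| X set0 erefl.
  by rewrite cards0; lia.
(* Exceptional vertices inside the chain need no care: the reservoir is only asked to cover vertices
   outside it. *)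
pose D' := D :\: (X :|: Y :|: C).
have cD' : #|D'| <= #|D| by apply: subset_leq_card; apply: subsetDl.
have cXYC : #|X :|: Y :|: C| <= #|X| + #|X| * (g + f) + f.
  by have := leq_cardU (X :|: Y) C; have := leq_cardU X Y; lia.
have [| |G1 [sG1 dG1 _ tG1]] := @cover_set D' (X :|: Y :|: C).
- by rewrite /D'; set_tac.
- by have : f * #|D'| <= f * #|D| by [rewrite leq_mul2l cD' orbT]; nia.
have [G2 [sG2 tG2 cL]] := greedy_tiling (~: (X :|: Y :|: C :|: G1)) dense.
set L := _ :\: G2 in cL.
have [| | |Z sZ [tZ _]] := @tiled_by_reservoir q X D L res.
- by rewrite /L; set_tac.
- by rewrite /L; rewrite /D' in sG1; set_tac.
- by rewrite (leq_trans _ leq_lq) // leq_mul2l cL orbT.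
(* The chain is evaluated last, on the ports that the reservoir step has left over. *)
have [C' sC' tC'] := chain (X :\: Z) (subsetDl _ _).
have tR : tiled (G1 :|: G2 :|: (L :|: Z) :|: (Y :|: (X :\: Z) :|: C')).
  rewrite /L in tZ *.
  apply: tiledU => //; first by set_tac.
  apply: tiledU => //; first by set_tac.
  by apply: tiledU => //; set_tac.
have dR : [disjoint G1 :|: G2 :|: (L :|: Z) :|: (Y :|: (X :\: Z) :|: C') & C :\: C'].
  by rewrite /L; set_tac.
have RT : (G1 :|: G2 :|: (L :|: Z) :|: (Y :|: (X :\: Z) :|: C')) :|: (C :\: C') = [set: V].
  by rewrite /L; set_tac.
have := cardU_disjoint dR; rewrite RT cardsT => cV.
have fC : f %| #|C :\: C'| by move: fV; rewrite cV dvdn_addr // tiled_dvd.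
have lt_f : #|C :\: C'| < f.
  by have := subset_leq_card (subsetDl C C'); lia.
(* By divisibility, all the vertices carried past the last port are used. *)
have C0 : C :\: C' = set0.
  by apply/eqP; rewrite -cards_eq0; move: fC; rewrite /dvdn modn_small.
by rewrite -RT C0 setU0.
Qed.

End Absorption.

End Tilings.

(** * Counting in cherry-dense graphs *)

Lemma bin_le_expn n j : 'C(n, j) <= n ^ j.
Proof.
apply: leq_trans (_ : n ^_ j <= _); first by rewrite -bin_ffact leq_pmulr ?fact_gt0.
by elim: j => // j IH; rewrite ffactnSr expnSr leq_mul // leq_subr.
Qed.

(** Each factor of the falling factorial is at least [n / 2]. *)
Lemma expn_le_bin n j : 2 * j <= n -> n ^ j <= 2 ^ j * j`! * 'C(n, j).
Proof.
move=> le_jn; rewrite -mulnA [j`! * _]mulnC bin_ffact.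
elim: j le_jn => // j IH le_jn.
rewrite ffactnSr !expnSr mulnACA leq_mul //; [by apply: IH; lia | by lia].
Qed.

(** Every such set arises by adding a vertex of [D] to a set of size [j]. *)
Lemma card_meeting (V : finType) (F : {set {set V}}) (D : {set V}) j :
  {in F, forall e : {set V}, #|e| = j.+1 /\ ~~ [disjoint e & D]} ->
  #|F| <= #|D| * #|V| ^ j.
Proof.
move=> FD.
have sF : F \subset [set de.1 |: de.2 | de in setX D [set e : {set V} | #|e| == j]].
  apply/subsetP => e /FD[ce /pred0Pn[d /= /andP[de dD]]].
  apply/imsetP; exists (d, e :\ d); last by rewrite /= setD1K.
  by rewrite !inE dD /= -(eqn_add2l (d \in e)) -cardsD1 ce de.
apply: leq_trans (subset_leq_card sF) _; apply: leq_trans (leq_imset_card _ _) _.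
by rewrite cardsX leq_mul2l card_draws bin_le_expn orbT.
Qed.

(** Union bound over the position of [x0]; once the position is fixed, deleting that entry is
    injective. *)
Lemma card_tuples_with (T : finType) (x0 : T) j :
  #|[set t : j.-tuple T | x0 \in t]| <= j * #|T| ^ j.-1.
Proof.
case: j => [|j]; first by rewrite leqn0 cards_eq0; apply/eqP/setP => -[[|y s] sz]; rewrite !inE.
pose At i := [set t : j.+1.-tuple T | tnth t i == x0].
have sA : [set t : j.+1.-tuple T | x0 \in t] \subset \bigcup_(i < j.+1) At i.
  apply/subsetP => t; rewrite inE => /tnthP[i x0E].
  by apply/bigcupP; exists i => //; rewrite inE -x0E.
apply: leq_trans (subset_leq_card sA) _.
apply: (@leq_trans (\sum_(i < j.+1) #|At i|)).
  elim/big_rec2: _ => [|i y A _ leAy]; first by rewrite cards0.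
  by rewrite (leq_trans (leq_cardU _ _)) // leq_add2l.
apply: (@leq_trans (\sum_(i < j.+1) #|T| ^ j)); last by rewrite sum_nat_const card_ord.
rewrite leq_sum // => i _.
pose del (t : j.+1.-tuple T) := [tuple tnth t (lift i l) | l < j].
rewrite -(card_tuple j T) -(card_in_imset (_ : {in At i &, injective del})) ?max_card //.
move=> t1 t2; rewrite !inE => /eqP t1i /eqP t2i eq_del.
apply: eq_from_tnth => l; case: (unliftP i l) => [l' ->|->]; last by rewrite t1i.
by have := congr1 (fun t => tnth t l') eq_del; rewrite !tnth_mktuple.
Qed.

Lemma exists_tuple (T : finType) m (P : {set m.-tuple T}) (s : seq T) (hs : size s == m) :
  [exists t in P, val t == s] = (Tuple hs \in P).
Proof.
apply/existsP/idP => [[t /andP[tP /eqP ts]]|sP]; last by exists (Tuple hs); rewrite sP eqxx.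
by rewrite (_ : Tuple hs = t) //; apply: val_inj.
Qed.

Section Cherry.

Local Open Scope ring_scope.

Variables (R : realType) (k : nat) (V : finType) (E : {set {set V}}) (p mu : R).
Hypothesis k_ge2 : (2 <= k)%N.
Hypothesis E_cherry : cherry_graph k E p mu.

Definition extending (a : V) (Q : {set {set V}}) : {set {set V}} :=
  [set e in Q | a |: e \in E].

(** The cherry condition is tested on the tuples [P] whose first entry is in [A] and on the tuples
    [Qt] that enumerate the members of [Q], one ordering per set. The pairs in [setX A Q] then
    correspond bijectively to [cherryK P Qt]. *)
Lemma cherry_pairs (A : {set V}) (Q : {set {set V}}) :
  {in Q, forall e : {set V}, #|e| = k.-1} ->
  p * (#|A| * #|Q|)%:R - mu * #|V|%:R ^+ k <=
    (\sum_(a in A) #|extending a Q|)%:R.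
Proof.
(* On [setX A Q] the list has length [k], so the default tuple is never taken there. *)
move=> cQ; pose h (ae : V * {set V}) : k.-tuple V :=
  insubd (nseq_tuple k ae.1) (ae.1 :: enum ae.2).
have valh ae : ae \in setX A Q -> val (h ae) = ae.1 :: enum ae.2.
  by rewrite inE => /andP[_ /cQ ce]; rewrite insubdK // unfold_in /= -cardE ce prednK // ltnW.
have memh z ae : ae \in setX A Q -> (z \in h ae) = (z \in ae.1 |: ae.2).
  by move=> aeAQ; rewrite [LHS](_ : _ = (z \in val (h ae))) // valh // !inE mem_enum.
have h_inj : {in setX A Q &, injective h}.
  move=> [a e] [a' e'] ae ae' /(congr1 val); rewrite !valh //= => -[-> ee'].
  by congr (_, _); apply/setP => x; rewrite -mem_enum ee' mem_enum.
pose P := [set t : k.-1.-tuple V | ohead t \in [set Some a | a in A]].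
pose Qt := [set t : k.-1.-tuple V | [exists e in Q, val t == enum e]].
have KE : cherryK P Qt = h @: setX A Q.
  apply/setP => x; rewrite inE; apply/andP/imsetP.
  - case=> /existsP[t /andP[tP /eqP xt]] /existsP[t' /andP[tQ /eqP xt']].
    move: tP; rewrite inE => /imsetP[a aA].
    move: tQ; rewrite inE => /existsP[e /andP[eQ /eqP te]] ta.
    have aeAQ : (a, e) \in setX A Q by rewrite inE /= aA.
    exists (a, e) => //; apply: val_inj; rewrite (valh _ aeAQ) /=.
    rewrite -te xt'; move: ta k_ge2; rewrite xt; case: (x) => -[|y s] /= /eqP <- //.
    by case: (s) => //= ? ? [->].
  - case=> -[a e] ae ->; rewrite (valh _ ae) /=.
    move: ae; rewrite inE /= => /andP[aA eQ].
    have sz_e : size (enum e) == k.-1 by rewrite -cardE cQ.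
    have sz_t : size (take k.-1 (a :: enum e)) == k.-1.
      by rewrite size_takel //= (eqP sz_e).
    rewrite !exists_tuple !inE /=; split.
      apply/imsetP; exists a => //.
      by move: k_ge2; case: (k) => [|[|j]].
    apply/existsP; exists e.
    by rewrite eQ /=.
have eE : [set x in cherryK P Qt | [set z | z \in x] \in E] =
          h @: [set ae in setX A Q | ae.1 |: ae.2 \in E].
  rewrite KE; apply/setP => x; rewrite inE; apply/andP/imsetP.
  - case=> /imsetP[ae aeAQ ->] hE; exists ae => //; rewrite inE aeAQ /=.
    rewrite (_ : _ |: _ = [set z | z \in h ae]) //; apply/setP => z.
    by rewrite [RHS]inE memh.
  - case=> ae; rewrite inE => /andP[aeAQ aeE] ->; split; first exact: imset_f.
    rewrite (_ : [set _ | _] = ae.1 |: ae.2) //; apply/setP => z.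
    by rewrite [LHS]inE memh.
have := E_cherry P Qt; rewrite /cherry_e eE KE card_in_imset // cardsX.
rewrite card_in_imset; last first.
  by move=> u v; rewrite !inE => /andP[uAQ _] /andP[vAQ _]; apply: h_inj; rewrite !inE.
move/le_trans; apply; rewrite ler_nat -sum1dep_card.
rewrite (eq_bigl (fun ae : V * {set V} =>
  (ae.1 \in A) && ((ae.2 \in Q) && (ae.1 |: ae.2 \in E)))); last first.
  by case=> a e; rewrite !inE andbA.
rewrite -(pair_big_dep _ (fun a e => (e \in Q) && (a |: e \in E)) (fun _ _ => 1%N)) /=.
by apply: leq_sum => a _; rewrite sum1dep_card.
Qed.

Definition poor (Q : {set {set V}}) : {set V} :=
  [set a | (#|extending a Q|%:R : R) < p / 2 * #|Q|%:R].

(** By [cherry_pairs] the poor vertices have average at least [p * #|Q|] extensions up to the error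
    term, yet each has less than half of that. *)
Lemma card_poor (Q : {set {set V}}) : {in Q, forall e : {set V}, #|e| = k.-1} ->
  #|poor Q|%:R * (p / 2 * #|Q|%:R) <= mu * #|V|%:R ^+ k.
Proof.
move=> cQ; have := cherry_pairs (poor Q) cQ.
have : (\sum_(a in poor Q) #|extending a Q|)%:R <= #|poor Q|%:R * (p / 2 * #|Q|%:R) :> R.
  rewrite natr_sum mulr_natl -sumr_const ler_sum // => a.
  by rewrite inE => /ltW.
rewrite natrM; lra.
Qed.

End Cherry.

(** * One-vertex extensions *)

Lemma card_option_sub (V : finType) (S : {set V}) :
  #|{: option {x : V | x \in S}}| = #|S|.+1.
Proof. by rewrite card_option card_sig; congr _.+1; apply: eq_card => x; rewrite !inE. Qed.

Section OneVertexExtension.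

Variables (V : finType) (S : {set V}) (E N : {set {set V}}).

Local Notation VS := (option {x : V | x \in S}).
Local Notation r := (insub : V -> VS).

(* [None] is the new vertex, with link [N]. *)
Definition extension : {set {set VS}} :=
  [set r @: e | e : {set V} in [set e in E | e \subset S]] :|:
  [set None |: r @: e | e : {set V} in [set e in N | e \subset S]].

(** Lets [v] play the role of the new vertex [None]. *)
Definition retract (v : V) (x : VS) : V := oapp val v x.

Lemma retractK v : {in S, cancel r (retract v)}.
Proof. by move=> x xS; rewrite /retract insubT. Qed.

Lemma retract_inj v : v \notin S -> injective (retract v).
Proof.
move=> vS [[x xS]|] [[y yS]|] //= xy.
- by congr Some; apply: val_inj.
- by rewrite -xy xS in vS.
- by rewrite xy yS in vS.
Qed.

Lemma insub_inj : {in S &, injective r}.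
Proof. by move=> x y xS yS; rewrite !insubT => -[]. Qed.

Lemma None_imset_insub (e : {set V}) : e \subset S -> None \notin r @: e.
Proof.
by move=> eS; apply/imsetP => -[x /(subsetP eS) xS]; rewrite insubT.
Qed.

Lemma imset_insub_inj (e e' : {set V}) : e \subset S -> e' \subset S ->
  r @: e = r @: e' -> e = e'.
Proof.
have sub (a b : {set V}) : a \subset S -> b \subset S -> r @: a = r @: b -> a \subset b.
  move=> aS bS ab; apply/subsetP => x xa.
  have : r x \in r @: b by rewrite -ab imset_f.
  by case/imsetP => y yb /insub_inj -> //; [apply: (subsetP aS) | apply: (subsetP bS)].
by move=> eS e'S ee'; apply/eqP; rewrite eqEsubset (sub e e') ?(sub e' e).
Qed.

Lemma retract_extension v (e : {set VS}) : 
  (forall e : {set V}, e \in N -> e \subset S -> v |: e \in E) ->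
  e \in extension -> retract v @: e \in E.
Proof.
have retr (e' : {set V}) : e' \subset S -> retract v @: (r @: e') = e'.
  move=> e'S; rewrite -imset_comp -[RHS]imset_id; apply: eq_in_imset => x xe'.
  by rewrite /= retractK // (subsetP e'S).
move=> NE /setUP[] /imsetP[e' + ->]; rewrite inE => /andP[e'E e'S].
  by rewrite retr.
by rewrite imsetU1 retr //=; apply: NE.
Qed.

Lemma extension_kgraph k : (0 < k)%N -> is_kgraph k E ->
  {in N, forall e : {set V}, #|e| = k.-1} -> is_kgraph k extension.
Proof.
move=> k0 /forall_inP Ek Nk; apply/forall_inP => e.
have cr (e' : {set V}) : e' \subset S -> #|r @: e'| = #|e'|.
  by move=> e'S; apply: card_in_imset => x y /(subsetP e'S) xS /(subsetP e'S) yS /insub_inj ->.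
case/setUP => /imsetP[e' + ->]; rewrite inE => /andP[e'E e'S].
  by rewrite cr // Ek.
by rewrite cardsU1 None_imset_insub // cr // Nk // add1n prednK.
Qed.

Lemma deg1_extension_None :
  #|[set e in N | e \subset S]| <= deg1 extension None.
Proof.
rewrite /deg1 -(card_in_imset (f := fun e : {set V} => None |: r @: e)).
  apply/subset_leq_card/subsetP => _ /imsetP[e eN ->].
  by rewrite inE setU11 andbT; apply/setUP; right; apply: imset_f.
move=> e e'; rewrite !inE => /andP[_ eS] /andP[_ e'S] ee'; apply: imset_insub_inj => //.
by rewrite -(setU1K (None_imset_insub eS)) ee' setU1K // None_imset_insub.
Qed.

Lemma deg1_extension_Some u :
  #|[set e in E | (val u \in e) && (e \subset S)]| <= deg1 extension (Some u).
Proof.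
rewrite /deg1 -(card_in_imset (f := fun e : {set V} => r @: e)).
  apply/subset_leq_card/subsetP => _ /imsetP[e + ->]; rewrite !inE => /and3P[eE ue eS].
  apply/andP; split.
    by apply/orP; left; apply: imset_f; rewrite inE eE.
  by apply/imsetP; exists (val u) => //; rewrite valK.
by move=> e e'; rewrite !inE => /and3P[_ _ eS] /and3P[_ _ e'S]; apply: imset_insub_inj.
Qed.

(** The set [T] is the copy without [None], hence chosen before [v]; any [v] whose link contains the
    relevant sets of [N] may then replace [None]. *)
Lemma copy_extension (W : finType) (EF : {set {set W}}) (S' : {set VS}) :
  copy_on EF extension S' -> None \in S' ->
  exists2 T : {set V}, T \subset S &
    forall v, v \notin S -> (forall e, e \in N -> e \subset S -> v |: e \in E) ->
      copy_on EF E (v |: T).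
Proof.
move=> [h [[h_inj hE] ->]] hN.
exists [set val u | u : {x | x \in S} & Some u \in h @: [set: W]].
  by apply/subsetP => _ /imsetP[u _ ->]; apply: valP.
move=> v vS NE; exists (retract v \o h); split.
  split; first exact: inj_comp (retract_inj vS) h_inj.
  by move=> e /hE he; rewrite imset_comp retract_extension.
rewrite [RHS]imset_comp; apply/setP => x; apply/setU1P/imsetP.
  case=> [->|/imsetP[u + ->]]; first by exists None.
  by rewrite inE => hu; exists (Some u).
case=> -[u|] hu ->; [right|by left].
by apply/imsetP; exists u => //; rewrite inE.
Qed.

(** * Transfer of the cherry condition to the extension *)

Definition lower j (A : {set j.-tuple VS}) : {set j.-tuple V} :=
  [set t : j.-tuple V | all [in S] t && (map_tuple r t \in A)].

Lemma map_insub_inj (s s' : seq V) : {in s, forall x, x \in S} ->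
  {in s', forall x, x \in S} -> map r s = map r s' -> s = s'.
Proof.
elim: s s' => [|x s IH] [|y s'] //= sS s'S [xy ss'].
have -> : x = y by apply: insub_inj => //; [apply: sS | apply: s'S]; rewrite mem_head.
congr (_ :: _); apply: IH => // z zs.
  by rewrite sS // inE zs orbT.
by rewrite s'S // inE zs orbT.
Qed.

Lemma card_lower j (A : {set j.-tuple VS}) : #|lower A| <= #|A|.
Proof.
rewrite -(card_in_imset (f := fun t : j.-tuple V => map_tuple r t)).
  by apply/subset_leq_card/subsetP => _ /imsetP[t + ->]; rewrite inE => /andP[].
move=> t t'; rewrite !inE => /andP[/allP tS _] /andP[/allP t'S _] /(congr1 val) /= tt'.
by apply/val_inj/map_insub_inj.
Qed.

(** Only the tuples containing [None] are lost, and [card_tuples_with] bounds their number. *)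
Lemma card_le_lower j (A : {set j.-tuple VS}) :
  #|A| <= #|lower A| + j * #|{: VS}| ^ j.-1.
Proof.
apply: leq_trans (_ : #|[set map_tuple r t | t in lower A] :|: 
    [set t : j.-tuple VS | None \in t]| <= _).
  apply/subset_leq_card/subsetP => t tA; rewrite !inE.
  case: (boolP (None \in t)) => [_|tN]; first by rewrite orbT.
  have tS : all isSome t.
    by apply/allP => -[//|] tN'; rewrite tN' in tN.
  have ts : map r (pmap (omap val) t) = t.
    elim: (val t) tS => //= -[u|] // s IH sS; rewrite /= IH // valK //.
  have sz : size (pmap (omap val) t) == j by rewrite -(size_map r) ts size_tuple.
  rewrite orbF; apply/imsetP; exists (Tuple sz); last exact/val_inj.
  rewrite inE /= (_ : map_tuple _ _ = t) ?tA ?andbT; last exact/val_inj.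
  by apply/allP => x; rewrite mem_pmap => /mapP[[u|] // _ [->]]; apply: valP.
apply: leq_trans (leq_cardU _ _) _; rewrite leq_add ?card_tuples_with //.
exact: leq_imset_card.
Qed.

(** A tuple has all entries in [S] exactly when its initial and its final segment do. *)
Lemma cherryK_lower j (P Q : {set j.+1.-tuple VS}) :
  cherryK (k := j.+2) (lower P) (lower Q) = lower (cherryK (k := j.+2) P Q).
Proof.
apply/setP => x; rewrite !inE.
case/tupleP: x => a s.
have szt : size (take j.+1 (a :: s)) == j.+1 by rewrite size_take /= size_tuple ltnSn.
have szs : size (behead (a :: s)) == j.+1 by rewrite /= size_tuple.
have szt' : size (take j.+1 (map r (a :: s))) == j.+1 by rewrite -map_take size_map.
have szs' : size (behead (map r (a :: s))) == j.+1 by rewrite /= size_map size_tuple.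
rewrite (exists_tuple _ szt) (exists_tuple _ szs) (exists_tuple _ szt') (exists_tuple _ szs') !inE.
have -> : map_tuple r (Tuple szt) = Tuple szt' by apply: val_inj; rewrite /= map_take.
have -> : map_tuple r (Tuple szs) = Tuple szs' by apply: val_inj.
rewrite /=; case: (a \in S) => //=; case: (boolP (all _ s)) => [sS|_]; last by rewrite !andbF.
have -> // : all [in S] (take j s).
by apply/allP => z /mem_take zs; apply: (allP sS).
Qed.

Lemma cherry_e_lower j (P Q : {set j.+1.-tuple VS}) :
  cherry_e (k := j.+2) E (lower P) (lower Q) <= cherry_e (k := j.+2) extension P Q.
Proof.
rewrite /cherry_e cherryK_lower; apply: leq_trans (card_lower _).
apply/subset_leq_card/subsetP => x; rewrite !inE => /andP[/andP[xS ->] xE].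
rewrite xS /=; apply/orP; left; apply/imsetP; exists [set z | z \in x].
  by rewrite inE xE; apply/subsetP => z; rewrite inE; apply: (allP xS).
apply/setP => z; rewrite inE; apply/mapP/imsetP => -[y yx ->]; exists y => //.
  by rewrite inE.
by rewrite inE in yx.
Qed.

End OneVertexExtension.

(** The new error has two sources: the tuples through [None], and the old error, now measured
    against the order of the extension. *)
Lemma extension_cherry (R : realType) (k : nat) (V : finType) (S : {set V})
    (E N : {set {set V}}) (p mu mu' : R) : (2 <= k)%N -> (0 <= p)%R ->
  cherry_graph k E p mu ->
  (p * (k * #|S|.+1 ^ k.-1)%:R + mu * #|V|%:R ^+ k <= mu' * #|S|.+1%:R ^+ k)%R ->
  cherry_graph k (extension S E N) p mu'.
Proof.
case: k => [|[|j]] // _ p0 Ech le_mu P Q.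
have := Ech (lower P) (lower Q); have := cherry_e_lower E N P Q.
rewrite cherryK_lower -(ler_nat R).
have := card_le_lower (cherryK P Q : {set j.+2.-tuple _}); rewrite card_option_sub -(ler_nat R) natrD.
move: (#|cherryK P Q|%:R : R)%R (#|lower _|%:R : R)%R => x y.
move/(ler_wpM2l p0); rewrite mulrDr; move: le_mu; lra.
Qed.

(** * Robust covering *)

Definition link (V : finType) (E : {set {set V}}) (v : V) : {set {set V}} :=
  [set e : {set V} | (v \notin e) && (v |: e \in E)].

Lemma card_link (V : finType) (E : {set {set V}}) (v : V) : #|link E v| = deg1 E v.
Proof.
rewrite /deg1 -(card_in_imset (f := fun e : {set V} => v |: e)).
  apply: eq_card => e; rewrite inE; apply/imsetP/andP => [[e' + ->]|[eE ve]].
    by rewrite inE setU11 => /andP[_ ->].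
  by exists (e :\ v); rewrite ?inE ?setD1K ?eqxx.
move=> e e'; rewrite !inE => /andP[ve _] /andP[ve' _] ee'.
by rewrite -(setU1K ve) ee' setU1K.
Qed.

Lemma notin_edge (V : finType) (E : {set {set V}}) (k : nat) v (e : {set V}) :
  is_kgraph k E -> (0 < k)%N -> #|e| = k.-1 -> v |: e \in E -> v \notin e.
Proof.
move=> /forall_inP Ek k0 ce /Ek; rewrite cardsU1 ce.
by case: (v \in e) => //; rewrite add0n => /eqP; lia.
Qed.

Lemma in_link (V : finType) (E : {set {set V}}) (k : nat) v (e : {set V}) :
  is_kgraph k E -> e \in link E v -> #|e| = k.-1 /\ v |: e \in E.
Proof.
move=> /forall_inP Ek; rewrite inE => /andP[ve eE]; split=> //.
by have /eqP <- := Ek _ eE; rewrite cardsU1 ve add1n.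
Qed.

Lemma card_avoiding (V : finType) (Q : {set {set V}}) (D : {set V}) j :
  {in Q, forall e : {set V}, #|e| = j.+1} ->
  #|Q| <= #|[set e in Q | [disjoint e & D]]| + #|D| * #|V| ^ j.
Proof.
move=> cQ; rewrite -(cardsID [set e : {set V} | [disjoint e & D]] Q) leq_add //.
  by apply/subset_leq_card/subsetP => e; rewrite !inE.
apply: card_meeting => e; rewrite !inE => /andP[eD eQ].
by rewrite cQ.
Qed.

Lemma deg1_extension_link (V : finType) (S : {set V}) (E N Q : {set {set V}})
    (u : {x | x \in S}) :
  {in Q, forall e : {set V}, val u \notin e /\ val u |: e \in E} ->
  #|[set e in Q | e \subset S]| <= deg1 (extension S E N) (Some u).
Proof.
move=> Qu; apply: leq_trans (deg1_extension_Some _ _ _).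
rewrite -(card_in_imset (f := fun e : {set V} => val u |: e)).
  apply/subset_leq_card/subsetP => _ /imsetP[e + ->]; rewrite !inE eqxx /= => /andP[/Qu[_ ->] eS].
  by rewrite subUset sub1set (valP u).
move=> e e'; rewrite !inE => /andP[/Qu[ue _] _] /andP[/Qu[ue' _] _] ee'.
by rewrite -(setU1K ue) ee' setU1K.
Qed.

Local Open Scope ring_scope.

(** Numerical condition of [extension_cherry], with [x] the old order and [y] the new one. Each of
    the two error terms gets half of [mu']. *)
Lemma cherry_slack (R : realType) (j : nat) (p mu mu' c x y : R) :
  0 < p < 1 -> 0 < mu' -> 0 < c -> 0 < x -> c * x <= y ->
  0 <= mu -> mu <= mu' / 2 * c ^+ j.+1 -> j.+1%:R <= mu' / 2 * (c * x) ->
  p * (j.+1%:R * y ^+ j) + mu * x ^+ j.+1 <= mu' * y ^+ j.+1.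
Proof.
move=> /andP[p0 p1] mu'0 c0 x0 cxy mu0 le_mu le_j.
have cx0 : 0 < c * x by apply: mulr_gt0.
have y0 : 0 < y by apply: lt_le_trans cxy.
have yj0 : 0 <= y ^+ j by rewrite exprn_ge0 // ltW.
have h1 : mu * x ^+ j.+1 <= mu' / 2 * y ^+ j.+1.
  apply: (@le_trans _ _ (mu' / 2 * c ^+ j.+1 * x ^+ j.+1)).
    by rewrite ler_wpM2r // exprn_ge0 // ltW.
  rewrite -mulrA -exprMn ler_wpM2l //; first by rewrite divr_ge0 // ltW.
  by rewrite lerXn2r // nnegrE ltW.
have h2 : p * (j.+1%:R * y ^+ j) <= mu' / 2 * y ^+ j.+1.
  rewrite exprS !mulrA ler_wpM2r //.
  apply: (@le_trans _ _ j.+1%:R).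
    by rewrite ler_piMl // ltW.
  apply: (le_trans le_j); rewrite ler_wpM2l //; by rewrite divr_ge0 // ltW.
lra.
Qed.

Section Robust.

Variables (R : realType) (j : nat) (W : finType) (EF : {set {set W}}).
Local Notation k := j.+2.

(* The same [T] serves all vertices whose link contains [N], which makes any two of
   them interchangeable. *)
Definition robustly_covering (V : finType) (E : {set {set V}}) (gam : R) : Prop :=
  forall (S : {set V}) (N : {set {set V}}) (v0 : V), v0 \notin S ->
  {in N, forall e : {set V}, e \subset S /\ #|e| = j.+1} ->
  gam * #|V|%:R ^+ j.+1 <= #|N|%:R ->
  exists2 T : {set V}, T \subset S &
    forall v, v \notin S -> {in N, forall e : {set V}, v |: e \in E} ->
      copy_on EF E (v |: T).

(** Remove from [S] the vertices that are poor for the family of all its [k - 1]-subsets, and add a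
    new vertex with link [N]. The result is cherry-dense with large minimum degree, so a copy of F
    contains the new vertex, and [copy_extension] applies. *)
Lemma robust_cover : COVER_cherry1 R k EF ->
  forall p gam : R, 0 < p < 1 -> 0 < gam < 1 ->
  exists (n0 : nat) (mu : R), 0 < mu /\
    forall (V : finType) (E : {set {set V}}) (mu0 : R),
      is_kgraph k E -> 0 <= mu0 <= mu -> cherry_graph k E p mu0 -> (n0 <= #|V|)%N ->
      robustly_covering E gam.
Proof.
move=> cov p gam p01 gam01; have [p0 p1] := andP p01; have [g0 g1] := andP gam01.
have pg0 : 0 < p * gam by apply: mulr_gt0.
have pg1 : p * gam < gam by rewrite gtr_pMl.
(* A vertex that is not poor keeps a proportion [p / 2 * gam] of link sets inside [S]; deleting the
   poor vertices costs at most half of it. *)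
have [|n1 [mu1 [mu10 {}cov]]] := cov p (p * gam / 4) p01; first by lra.
(* [mu2] serves [cherry_slack] with [c = gam / 2], and [mu3] keeps the number of poor vertices below
   [p * gam / 4 * #|V|]. *)
pose mu2 := mu1 / 2 * (gam / 2) ^+ k.
pose mu3 := (p * gam) ^+ 2 / 8.
have mg0 : 0 < mu1 * (gam / 2) by rewrite mulr_gt0 ?divr_gt0.
have x1_ge0 : 0 <= 2 * n1%:R / gam :> R by rewrite divr_ge0 ?mulr_ge0 // ltW.
have x2_gt0 : 0 < 2 * k%:R / (mu1 * (gam / 2)) by apply: divr_gt0 => //; rewrite mulr_gt0 ?ltr0n.
pose x0 := 2 * n1%:R / gam + 2 * k%:R / (mu1 * (gam / 2)).
exists (Num.truncn x0).+1, (Num.min mu2 mu3); split.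
  by rewrite lt_min mulr_gt0 ?exprn_gt0 ?divr_gt0 ?exprn_gt0.
move=> V E mu0 Ek /andP[mu00]; rewrite le_min => /andP[le_mu2 le_mu3] Ech le_n.
move=> S N v0 v0S NS le_N.
set x : R := #|V|%:R in le_N *.
have lt_x : x0 < x.
  by apply: lt_le_trans (truncnS_gt x0) _; rewrite ler_nat.
have xn1 : 2 * n1%:R / gam <= x.
  by apply: le_trans (ltW lt_x); rewrite /x0 lerDl ltW.
have xk : 2 * k%:R / (mu1 * (gam / 2)) <= x.
  by apply: le_trans (ltW lt_x); rewrite /x0 lerDr.
have x_gt0 : 0 < x.
  by apply: lt_le_trans xk.
have xj0 i : 0 < x ^+ i by rewrite exprn_gt0.
pose QS := [set e : {set V} | e \subset S & #|e| == j.+1].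
have cQS : {in QS, forall e : {set V}, #|e| = k.-1} by move=> e; rewrite inE => /andP[_ /eqP].
have le_QS : gam * x ^+ j.+1 <= #|QS|%:R.
  apply: le_trans le_N _; rewrite ler_nat; apply/subset_leq_card/subsetP => e /NS[eS ce].
  by rewrite inE eS ce eqxx.
set D := poor E p QS.
have cD : #|D|%:R <= p * gam / 4 * x.
  have := card_poor (k := j.+2) isT Ech cQS; rewrite -/D -/x => cD.
  have {cD} : #|D|%:R * (p / 2 * gam) * x ^+ j.+1 <= mu0 * x * x ^+ j.+1.
    rewrite -[mu0 * x * _]mulrA -exprS; apply: le_trans cD.
    by rewrite -!mulrA !ler_wpM2l // ?ler0n // ?invr_ge0 ?ltW.
  rewrite ler_pM2r // => cD.
  have : #|D|%:R * (p / 2 * gam) <= (p * gam) ^+ 2 / 8 * x.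
    by apply: le_trans cD _; rewrite ler_wpM2r // ltW.
  rewrite -[X in _ <= X](_ : (p * gam / 4 * x) * (p / 2 * gam) = _); last by field.
  by rewrite ler_pM2r // mulr_gt0 ?divr_gt0.
pose S' := S :\: D.
have cS : gam * x <= #|S|%:R.
  have : (#|N| <= #|S| * #|V| ^ j)%N.
    apply: card_meeting => e /NS[eS ce]; split=> //.
    have /card_gt0P[z ze] : (0 < #|e|)%N by rewrite ce.
    by apply/pred0Pn; exists z; rewrite /= ze (subsetP eS).
  rewrite -(ler_nat R) natrM natrX -/x => /(le_trans le_N).
  by rewrite exprS mulrA ler_pM2r.
set y : R := #|S'|.+1%:R.
have cS' : gam / 2 * x <= y.
  have : (#|S| <= #|S'| + #|D|)%N.
    by rewrite -(cardsID D S) addnC leq_add // subset_leq_card // subsetIr.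
  rewrite -(ler_nat R) natrD /y -[#|S'|.+1%:R]natr1 => h.
  have : p * gam * x <= gam * x by rewrite ler_wpM2r // ltW.
  have : 0 < gam * x by rewrite mulr_gt0.
  lra.
(* Since [S] misses [v0], adding one vertex does not push the order above [#|V|]. *)
have yx : y <= x.
  rewrite ler_nat; apply: leq_trans (_ : #|v0 |: S'| <= _)%N; last exact: max_card.
  by rewrite cardsU1 /S' inE negb_and v0S orbT.
have y0 : 0 <= y by rewrite ler0n.
have yxj : p * gam / 4 * y ^+ j.+1 <= p * gam / 4 * x ^+ j.+1.
  by rewrite ler_wpM2l ?lerXn2r ?nnegrE //; lra.
have NS' : {in N, forall e : {set V}, #|e| = j.+1} by move=> e /NS[].
have subS' (Q : {set {set V}}) : {in Q, forall e : {set V}, e \subset S /\ #|e| = j.+1} ->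
    #|Q|%:R - p * gam / 4 * x ^+ j.+1 <= #|[set e in Q | e \subset S']|%:R :> R.
  move=> QS'; have cQ : {in Q, forall e : {set V}, #|e| = j.+1} by move=> e /QS'[].
  have := card_avoiding D cQ; rewrite -(ler_nat R) natrD natrM natrX -/x.
  have : #|[set e in Q | [disjoint e & D]]|%:R <= #|[set e in Q | e \subset S']|%:R :> R.
    rewrite ler_nat; apply/subset_leq_card/subsetP => e; rewrite !inE => /andP[eQ eD].
    by rewrite eQ subsetD eD andbT; case: (QS' e eQ).
  have : #|D|%:R * x ^+ j <= p * gam / 4 * x * x ^+ j by rewrite ler_wpM2r // ltW.
  rewrite exprS mulrA; lra.
have Xk : 0 < p * gam * x ^+ j.+1 by rewrite mulr_gt0.
have [||||S'' [cS'' NS'']] := cov _ (extension S' E N) _ _ _ _ None.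
- by apply: extension_kgraph.
- apply: extension_cherry Ech _ => //; first exact: ltW.
  rewrite natrM natrX -/x -/y; apply: (@cherry_slack _ _ p mu0 mu1 (gam / 2)) => //; first by lra.
  have : 0 < mu1 * (gam / 2) by rewrite mulr_gt0 ?divr_gt0.
  by move: xk => /[swap] ?; rewrite ler_pdivrMr //; lra.
- case=> [u|]; rewrite card_option_sub -/y; apply: (le_trans yxj).
    apply: (@le_trans _ _ (#|[set e in extending E (val u) QS | e \subset S']|%:R)).
      have uD : val u \notin D by have := valP u; rewrite /S' inE => /andP[].
      have le_u : p / 2 * #|QS|%:R <= #|extending E (val u) QS|%:R.
        by move: uD; rewrite inE -leNgt.
      have : p / 2 * (gam * x ^+ j.+1) <= p / 2 * #|QS|%:R by rewrite ler_wpM2l // divr_ge0 // ltW.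
      have extS : {in extending E (val u) QS, forall e : {set V}, e \subset S /\ #|e| = j.+1}.
        by move=> e; rewrite !inE => /andP[/andP[eS /eqP ce] _].
      have := subS' _ extS; move: le_u le_QS; lra.
    rewrite ler_nat; apply: deg1_extension_link => e; rewrite !inE => /andP[/andP[_ /eqP ce] ueE].
    by split=> //; apply: (notin_edge Ek _ ce ueE).
  apply: (@le_trans _ _ (#|[set e in N | e \subset S']|%:R)); last first.
    by rewrite ler_nat deg1_extension_None.
  have := subS' N NS; have : p * gam * x ^+ j.+1 <= gam * x ^+ j.+1 by rewrite ler_wpM2r // ltW.
  move: le_N; lra.
- rewrite card_option_sub -(ler_nat R) -/y; apply: le_trans cS'.
  by move: xn1; rewrite ler_pdivrMr //; lra.
have [T TS' copyT] := copy_extension cS'' NS''.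
exists T; first exact: subset_trans TS' (subsetDl _ _).
move=> v vS vN; apply: copyT; first by rewrite /S' inE negb_and vS orbT.
by move=> e eN _; apply: vN.
Qed.

End Robust.

(** * The two inclusions *)

(** A given vertex [v] is deleted together with [#|V| %% #|W|] others and returns as the new vertex
    [None] with its old link. A factor of the extension contains a copy through [None]. *)
Lemma factor_implies_cover (R : realType) (j : nat) (W : finType) (EF : {set {set W}}) :
  (0 < #|W|)%N -> FACTOR_cherry1 R j.+2 EF -> COVER_cherry1 R j.+2 EF.
Proof.
move=> f0 fac p al p01 al01; have [p0 p1] := andP p01; have [al0 al1] := andP al01.
have [|n1 [mu1 [mu10 {}fac]]] := fac p (al / 2) p01; first by lra.
pose f : R := #|W|%:R.
have f_ge0 : 0 <= f by rewrite ler0n.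
have a2 : 0 <= 2 * f / al by rewrite divr_ge0 ?mulr_ge0 // ltW.
have a1 : 0 < 4 * j.+2%:R / mu1 by apply: divr_gt0 => //; rewrite mulr_gt0 ?ltr0n.
(* The first two terms keep the new order above [n1] and [#|V| / 2], the third serves [cherry_slack]
   with [c = 1 / 2], and the last lets the deletion cost at most half of the degree. *)
pose x0 := n1%:R + 2 * f + 4 * j.+2%:R / mu1 + 2 * f / al.
exists (Num.truncn x0).+1, (mu1 / 2 * (1 / 2) ^+ j.+2); split.
  by rewrite mulr_gt0 ?exprn_gt0 ?divr_gt0.
move=> V E Ek Ech deg le_n v.
set x : R := #|V|%:R in deg *.
have lt_x : x0 < x.
  by apply: lt_le_trans (truncnS_gt x0) _; rewrite ler_nat.
have n1_ge0 : 0 <= n1%:R :> R by rewrite ler0n.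
rewrite /x0 in lt_x.
have xk : 4 * j.+2%:R / mu1 <= x by lra.
have xf : 2 * f / al <= x by lra.
have x_gt0 : 0 < x by lra.
have xj0 i : 0 < x ^+ i by rewrite exprn_gt0.
have x2f : (2 * #|W| < #|V|)%N.
  by rewrite -(ltr_nat R) natrM -/f -/x; lra.
have xn1f : (n1 + #|W| < #|V|)%N.
  by rewrite -(ltr_nat R) natrD -/f -/x; lra.
have [q [r [lt_r Vqr]]] : exists q r, (r < #|W|)%N /\ #|V| = (q * #|W| + r)%N.
  by exists (#|V| %/ #|W|)%N, (#|V| %% #|W|)%N; rewrite ltn_pmod // -divn_eq.
have [A sA cA] : exists2 A : {set V}, A \subset ~: [set v] & #|A| = r.
  by apply: subset_of_card; have := cardsC [set v]; rewrite cards1; move: x2f lt_r; clear; lia.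
pose D := v |: A; pose S := ~: D.
have cD : #|D| = r.+1.
  by rewrite cardsU1 cA (contraTN _ (isT : true)) //= => /(subsetP sA); rewrite !inE eqxx.
have cS1 : #|S|.+1 = (#|V| - r)%N.
  by have := cardsC D; rewrite cD -/S; move: x2f lt_r; clear; lia.
set y : R := #|S|.+1%:R.
have yx : y <= x by rewrite ler_nat cS1 leq_subr.
have y0 : 0 <= y by rewrite ler0n.
have cxy : 1 / 2 * x <= y.
  have : (#|V| <= 2 * #|S|.+1)%N by rewrite cS1; move: x2f lt_r; clear; lia.
  by rewrite -(ler_nat R) natrM -/x -/y; lra.
have Df : #|D|%:R <= f by rewrite ler_nat cD.
have DX : #|D|%:R * x ^+ j <= al / 2 * x ^+ j.+1.
  rewrite exprS mulrA ler_wpM2r //; first exact: ltW.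
  by move: xf; rewrite ler_pdivrMr //; lra.
have yxj : al / 2 * y ^+ j.+1 <= al / 2 * x ^+ j.+1.
  by rewrite ler_wpM2l ?lerXn2r ?nnegrE //; lra.
have link_S u : al / 2 * x ^+ j.+1 <= #|[set e in link E u | e \subset S]|%:R.
  have cl : {in link E u, forall e : {set V}, #|e| = j.+1} by move=> e /(in_link Ek)[].
  have := card_avoiding D cl; rewrite -(ler_nat R) natrD natrM natrX -/x card_link.
  have -> : [set e in link E u | [disjoint e & D]] = [set e in link E u | e \subset S].
    by apply/setP => e; rewrite !inE disjoints_subset.
  by have := deg u; move: DX; rewrite /=; lra.
have [|||||Pt [ptP copyPt]] := fac _ (extension S E (link E v)).
- by apply: extension_kgraph => // e /(in_link Ek)[].
- apply: extension_cherry Ech _ => //; first exact: ltW.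
  rewrite natrM natrX -/x -/y; apply: (@cherry_slack _ _ p _ mu1 (1 / 2)) => //.
  + lra.
  + by rewrite ltW // mulr_gt0 ?exprn_gt0 ?divr_gt0.
  + by move: xk; rewrite ler_pdivrMr //; lra.
- case=> [u|]; rewrite card_option_sub -/y /=; apply: (le_trans yxj).
    apply: le_trans (link_S (val u)) _; rewrite ler_nat.
    by apply: deg1_extension_link => e; rewrite inE => /andP[].
  by apply: le_trans (link_S v) _; rewrite ler_nat deg1_extension_None.
- by rewrite card_option_sub cS1; move: xn1f lt_r; clear; lia.
- by rewrite card_option_sub cS1 Vqr addnK dvdn_mull.
have /bigcupP[B BP NB] : None \in cover Pt by rewrite (cover_partition ptP) inE.
have [T TS copyT] := copy_extension (copyPt B BP) NB.
exists (v |: T); rewrite setU11; split=> //; apply: copyT.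
  by rewrite !inE eqxx.
by move=> e; rewrite inE => /andP[].
Qed.

(** * Covering, exchanging and the reservoir property from robust covering *)

Section CoverToFactor.

Variables (R : realType) (j : nat) (W V : finType).
Variables (EF : {set {set W}}) (E : {set {set V}}) (p mu al gam : R).
Local Notation k := j.+2.
Local Notation f := #|W|.
Local Notation x := (#|V|%:R : R).
Hypothesis f_gt0 : (0 < f)%N.
Hypothesis x_gt0 : 0 < x.
Hypothesis p_gt0 : 0 < p.
Hypothesis Ek : is_kgraph k E.
Hypothesis Ech : cherry_graph k E p mu.
Hypothesis Edeg : forall v : V, al * x ^+ j.+1 <= (deg1 E v)%:R.
Hypothesis Erob : robustly_covering j EF E gam.

(** At most [#|D| * #|V| ^ j] members of [Q] meet [D]; robustness is applied to the others inside
    [S :\: D]. *)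
Lemma robust_avoiding (S D : {set V}) (Q : {set {set V}}) v0 : v0 \notin S :\: D ->
  {in Q, forall e : {set V}, e \subset S /\ #|e| = j.+1} ->
  (gam * x + #|D|%:R) * x ^+ j <= #|Q|%:R ->
  exists2 T : {set V}, T \subset S :\: D &
    forall v, v \notin S :\: D -> {in Q, forall e : {set V}, v |: e \in E} ->
      copy_on EF E (v |: T).
Proof.
move=> v0S QS le_Q.
have [||T TS copyT] := Erob (N := [set e in Q | e \subset S :\: D]) v0S.
- by move=> e; rewrite inE => /andP[/QS[_ ce] eS].
- have cQ : {in Q, forall e : {set V}, #|e| = j.+1} by move=> e /QS[].
  have := card_avoiding D cQ; rewrite -(ler_nat R) natrD natrM natrX.
  have -> : [set e in Q | [disjoint e & D]] = [set e in Q | e \subset S :\: D].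
    apply/setP => e; rewrite !inE subsetD; case: (boolP (e \in Q)) => //= /QS[-> _] //.
  by move: le_Q; rewrite exprS mulrDl mulrA; lra.
exists T => // v vS vQ; apply: copyT => // e; rewrite inE => /andP[eQ _]; exact: vQ.
Qed.

Lemma card_link_ge v : al * x ^+ j.+1 <= #|link E v|%:R.
Proof. by rewrite card_link. Qed.

Lemma link_extends v : {in link E v, forall e : {set V}, e \subset [set: V] /\ #|e| = j.+1}.
Proof. by move=> e /(in_link Ek)[ce _]; rewrite subsetT. Qed.

Lemma cover_avoiding v (U : {set V}) : gam * x + (#|U| + 1)%:R <= al * x -> v \notin U ->
  exists2 T : {set V}, [disjoint T & v |: U] & copy_on EF E (v |: T).
Proof.
move=> le_U vU.
have vT : v \notin [set: V] :\: (v |: U) by rewrite !inE eqxx.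
have [|T TS copyT] := robust_avoiding vT (@link_extends v).
  apply: le_trans (card_link_ge v); rewrite exprS mulrA ler_wpM2r //.
    by rewrite exprn_ge0 // ltW.
  by rewrite cardsU1 vU addnC.
exists T; first by rewrite setTD in TS; rewrite disjoints_subset.
by apply: copyT => // e /(in_link Ek)[].
Qed.

Lemma card_poor_link v : #|poor E p (link E v)|%:R * (p / 2 * al) <= mu * x.
Proof.
have cl : {in link E v, forall e : {set V}, #|e| = k.-1} by move=> e /(in_link Ek)[].
have cP := card_poor (k := k) isT Ech cl.
rewrite -(ler_pM2r (exprn_gt0 j.+1 x_gt0)) -[mu * x * _]mulrA -exprS; apply: le_trans cP.
by rewrite -!mulrA !ler_wpM2l ?card_link_ge ?invr_ge0 ?ler0n // ltW.
Qed.

Lemma half_extending v w : w \notin poor E p (link E v) ->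
  p / 2 * al * x ^+ j.+1 <= #|extending E w (link E v)|%:R.
Proof.
rewrite inE -leNgt; apply: le_trans.
by rewrite -mulrA ler_wpM2l ?card_link_ge // divr_ge0 // ltW.
Qed.

(* A vertex [w] outside [poor (link u)] and [poor (link v)] shares many link sets with
   both [u] and [v]; it is exchanged first with [u], then with [v]. *)
Lemma connect_avoiding u v (U : {set V}) : u != v ->
  gam * x + (#|U| + f + 3)%:R <= p / 2 * al * x ->
  (#|poor E p (link E u)| + #|poor E p (link E v)| + #|U| + 2 < #|V|)%N ->
  exists T : {set V}, [/\ (#|T| <= 2 * f)%N, [disjoint T & u |: (v |: U)],
    tiled EF E (u |: T) & tiled EF E (v |: T)].
Proof.
move=> neq_uv le_U lt_poor.
pose B := poor E p (link E u) :|: poor E p (link E v) :|: (u |: (v |: U)).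
have lt_B : (#|B| < #|V|)%N.
  apply: leq_ltn_trans lt_poor.
  apply: leq_trans (leq_cardU _ _) _; rewrite -!addnA addnA leq_add ?leq_cardU //.
  by rewrite addn2 !(leq_trans (leq_cardU1 _ _)) ?ltnS ?leq_cardU1.
have /card_gt0P[w] : (0 < #|~: B|)%N by have := cardsC B; move: lt_B; clear; lia.
rewrite !inE !negb_or -!andbA => /and5P[wu wv neq_wu neq_wv wU].
have wpu : w \notin poor E p (link E u) by rewrite inE.
have wpv : w \notin poor E p (link E v) by rewrite inE.
have ext_in z : {in extending E w (link E z),
    forall e : {set V}, [/\ e \subset [set: V] /\ #|e| = j.+1, z |: e \in E & w |: e \in E]}.
  by move=> e; rewrite inE => /andP[/(in_link Ek)[ce zE] wE]; rewrite subsetT.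
have xj : 0 <= x ^+ j by rewrite exprn_ge0 // ltW.
have exchange1 z (D : {set V}) : w \notin poor E p (link E z) -> z \in D -> w \in D ->
    (#|D| <= #|U| + f + 3)%N ->
    exists T : {set V}, [/\ [disjoint T & D], copy_on EF E (z |: T) & copy_on EF E (w |: T)].
  move=> wz zD wD le_D.
  have zT : z \notin [set: V] :\: D by rewrite inE zD.
  have [||T TS copyT] := robust_avoiding zT (Q := extending E w (link E z)).
  - by move=> e /ext_in[].
  - apply: le_trans (half_extending wz); rewrite exprS mulrA ler_wpM2r //.
    by apply: le_trans le_U; rewrite lerD2l ler_nat.
  exists T; split; first by rewrite setTD in TS; rewrite disjoints_subset.
    by apply: copyT => // e /ext_in[].
  by apply: copyT; [rewrite inE wD | move=> e /ext_in[]].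
pose D0 := w |: (u |: (v |: U)).
have cD0 : (#|D0| <= #|U| + 3)%N.
  by rewrite addn3; do 3 (apply: leq_trans (leq_cardU1 _ _) _; rewrite ltnS).
have [|||T1 [dT1 uT1 wT1]] := exchange1 u D0 wpu; rewrite ?/D0 ?inE ?eqxx ?orbT //.
  by rewrite (leq_trans cD0) // leq_add2r leq_addr.
have cT1 : (#|T1| < f)%N.
  rewrite -(copy_card uT1) cardsU1.
  have -> // : u \notin T1.
  by apply: contraL dT1 => uT; apply/pred0Pn; exists u; rewrite /= uT !inE eqxx orbT.
have [|||T2 [dT2 vT2 wT2]] := exchange1 v (D0 :|: T1) wpv; rewrite ?/D0 ?inE ?eqxx ?orbT //.
  by apply: leq_trans (leq_cardU _ _) _; rewrite (leq_trans (leq_add cD0 (ltnW cT1))) // addnAC.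
have cT2 : (#|T2| < f)%N.
  rewrite -(copy_card vT2) cardsU1.
  have -> // : v \notin T2.
  by apply: contraL dT2 => vT; apply/pred0Pn; exists v; rewrite /= vT !inE eqxx !orbT.
have disT z : z \in D0 -> z \notin T1 /\ z \notin T2.
  by move=> zD; rewrite (disjointFl dT1 zD) (disjointFl dT2) // inE zD.
have [wT1' wT2'] : w \notin T1 /\ w \notin T2 by apply: disT; rewrite !inE eqxx.
have [uT1' uT2'] : u \notin T1 /\ u \notin T2 by apply: disT; rewrite !inE eqxx !orbT.
have [vT1' vT2'] : v \notin T1 /\ v \notin T2 by apply: disT; rewrite !inE eqxx !orbT.
(* With [u] the copies are [u |: T1] and [w |: T2]; with [v] they are [v |: T2] and [w |: T1]. *)
exists (w |: (T1 :|: T2)); split.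
- rewrite cardsU1; have := leq_cardU T1 T2; move: cT1 cT2; clear; case: (w \notin _); lia.
- rewrite disjointsU ?disjoints1 //; first by rewrite !inE !negb_or neq_wu neq_wv.
  by rewrite disjointsU //; rewrite /D0 in dT1 dT2; set_tac.
- have -> : u |: (w |: (T1 :|: T2)) = (u |: T1) :|: (w |: T2) by set_tac.
  apply: tiledU; [| exact: tiled_copy | exact: tiled_copy].
  rewrite disjointsU ?disjoints1 //; first by rewrite !inE negb_or eq_sym neq_wu.
  rewrite disjoint_sym disjointsU ?disjoints1 //; set_tac.
- have -> : v |: (w |: (T1 :|: T2)) = (v |: T2) :|: (w |: T1) by set_tac.
  apply: tiledU; [| exact: tiled_copy | exact: tiled_copy].
  rewrite disjointsU ?disjoints1 //; first by rewrite !inE negb_or eq_sym neq_wv.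
  rewrite disjoint_sym disjointsU ?disjoints1 //; set_tac.
Qed.

Definition draws (S : {set V}) : {set {set V}} :=
  [set e : {set V} | e \subset S & #|e| == j.+1].

Lemma in_draws S : {in draws S, forall e : {set V}, #|e| = k.-1}.
Proof. by move=> e; rewrite inE => /andP[_ /eqP]. Qed.

Lemma copy_in_reservoir (S Z : {set V}) v : v \notin S -> v \notin poor E p (draws S) ->
  (gam * x + #|Z|%:R) * x ^+ j <= p / 2 * #|draws S|%:R ->
  exists2 T : {set V}, T \subset S :\: Z & copy_on EF E (v |: T).
Proof.
move=> vS; rewrite inE -leNgt => vp le_Z.
have vSZ : v \notin S :\: Z by rewrite inE (negPf vS) andbF.
have [||T TS copyT] := robust_avoiding vSZ (Q := extending E v (draws S)).
- by move=> e; rewrite !inE => /andP[/andP[-> /eqP]].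
- exact: le_trans vp.
exists T => //; apply: copyT => // e; by rewrite inE => /andP[].
Qed.

(** There are too few poor vertices to fill [S]. A vertex of [S] that is not poor is covered inside
    [S], with itself removed from the set in which the rest of the copy is sought. *)
Lemma copy_in_dense (S : {set V}) :
  mu * x ^+ k < #|S|%:R * (p / 2 * #|draws S|%:R) ->
  (gam * x + 1) * x ^+ j <= p / 2 * #|draws S|%:R ->
  exists2 T : {set V}, T \subset S & copy_on EF E T.
Proof.
move=> lt_mu le_S.
have /subsetPn[v vS vp] : ~~ (S \subset poor E p (draws S)).
  apply/negP => /subset_leq_card; rewrite -(ler_nat R) => le_poor.
  have := card_poor (k := k) isT Ech (@in_draws S).
  rewrite leNgt (lt_le_trans lt_mu) // ler_wpM2r //.
  by rewrite mulr_ge0 ?divr_ge0 // ltW.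
have vSv : v \notin S :\: [set v] by rewrite !inE eqxx.
have [||T TS copyT] := robust_avoiding vSv (Q := extending E v (draws S)).
- by move=> e; rewrite !inE => /andP[/andP[-> /eqP]].
- by rewrite cards1; move: vp; rewrite inE -leNgt; apply: le_trans.
exists (v |: T); last by apply: copyT => // e; rewrite inE => /andP[].
by rewrite subUset sub1set vS (subset_trans TS) // subsetDl.
Qed.

End CoverToFactor.

Lemma card_draws_ge (R : realType) (j : nat) (V : finType) (S : {set V}) (y : R) :
  0 <= y <= #|S|%:R -> (2 * j.+1 <= #|S|)%N ->
  (2 ^ j.+1 * j.+1`!)%:R^-1 * y ^+ j.+1 <= #|draws j S|%:R.
Proof.
move=> /andP[y0 yS] le_S.
have c0 : 0 < (2 ^ j.+1 * j.+1`!)%:R :> R by rewrite ltr0n muln_gt0 expn_gt0 fact_gt0.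
rewrite ler_pdivrMl // -natrM /draws cards_draws.
apply: (@le_trans _ _ (#|S|%:R ^+ j.+1)); first by rewrite lerXn2r ?nnegrE ?ler0n.
by rewrite -natrX ler_nat expn_le_bin.
Qed.

Lemma cover_implies_factor (R : realType) (j : nat) (W : finType) (EF : {set {set W}}) :
  (0 < #|W|)%N -> COVER_cherry1 R j.+2 EF -> FACTOR_cherry1 R j.+2 EF.
Proof.
move=> f0 cov p al p01 al01; have [p0 p1] := andP p01; have [al0 al1] := andP al01.
pose f : R := #|W|%:R.
pose K := (2 * gadget_size #|W| + 4 * #|W| + 2)%N.
(* A vertex outside [poor E p (link E v)] shares with [v] at least a proportion [2 * kap] of link
   sets. The value of [bet] makes [#|X|] gadgets of cost [K] fit into [kap * x / 8]. *)
pose kap := p * al / 4.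
pose bet := kap / (8 * K%:R).
pose c0 : R := (2 ^ j.+1 * j.+1`!)%:R^-1.
(* A vertex that is not poor for [X] has a proportion [2 * tau] of link sets in [X], so [tau * x]
   vertices of [X] may be spent. The greedy leftover [xi * x] needs at most half of these. In a set
   of size [xi * x], [sig] is the corresponding proportion of link sets. *)
pose tau := p / 4 * (c0 * (bet / 2) ^+ j.+1).
pose xi := tau / (2 * f).
pose sig := p / 2 * (c0 * xi ^+ j.+1).
pose gam := Num.min kap (Num.min tau sig) / 2.
have fR : 1 <= f by rewrite ler1n.
have KR : 1 <= K%:R :> R by rewrite ler1n /K addn2.
have f_gt0 : 0 < f by lra.
have kap0 : 0 < kap by rewrite !divr_gt0 ?mulr_gt0.
have kapal : kap <= al / 4 by rewrite ler_wpM2r ?invr_ge0 // ler_piMl // ltW.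
have c00 : 0 < c0 by rewrite invr_gt0 ltr0n muln_gt0 expn_gt0 fact_gt0.
have bet0 : 0 < bet by rewrite divr_gt0 // mulr_gt0 //; lra.
have betK : bet * K%:R = kap / 8 by rewrite /bet; field; lra.
have b2 : 0 < (bet / 2) ^+ j.+1 by rewrite exprn_gt0 // divr_gt0.
have tau0 : 0 < tau by apply: mulr_gt0; [exact: divr_gt0 | exact: mulr_gt0].
have xi0 : 0 < xi by rewrite divr_gt0 // mulr_gt0.
have xif : xi * f = tau / 2 by rewrite /xi; field; lra.
have sig0 : 0 < sig.
  by apply: mulr_gt0; [exact: divr_gt0 | apply: mulr_gt0 => //; exact: exprn_gt0].
have gam0 : 0 < gam by rewrite divr_gt0 // !lt_min kap0 tau0.
have [gkap gtau gsig] : [/\ gam <= kap / 2, gam <= tau / 2 & gam <= sig / 2].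
  by split; rewrite ler_pM2r ?invr_gt0 // !ge_min lexx ?orbT.
have [|n1 [mu1 [mu10 rob]]] := robust_cover cov p01 (_ : 0 < gam < 1); first by rewrite gam0; lra.
pose mu2 := tau * kap / (4 * f).
have mu20 : 0 < mu2 by apply: divr_gt0; exact: mulr_gt0.
have mu2f : mu2 * f = tau * kap / 4 by rewrite /mu2; field; lra.
(* In order: robust covering, few vertices that are poor for [X], few that are poor for a given
   link, and copies in every set of [xi * x] vertices. *)
pose mu := Num.min mu1 (Num.min mu2 (Num.min (kap / 4) (xi * sig / 2))).
have mu0 : 0 < mu by rewrite !lt_min mu10 mu20 !divr_gt0 // mulr_gt0.
have [lmu1 lmu2 lmu3 lmu4] : [/\ mu <= mu1, mu <= mu2, mu <= kap / 4 & mu <= xi * sig / 2].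
  by split; rewrite !ge_min lexx ?orbT.
pose x0 := n1%:R + 8 + (f + 3 + 4 * K%:R) / kap + 4 * j.+1%:R / bet +
  2 * j.+1%:R / xi + 2 / sig.
exists (Num.truncn x0).+1, mu; split=> // V E Ek Ech deg le_n fV.
set x : R := #|V|%:R in deg.
have lt_x : x0 < x.
  by apply: lt_le_trans (truncnS_gt x0) _; rewrite ler_nat.
have jR : 1 <= j.+1%:R :> R by rewrite ler1n.
have [xn x8 xkap xbet [xxi xsig]] : [/\ n1%:R <= x, 8 <= x, f + 3 + 4 * K%:R <= x * kap,
    4 * j.+1%:R <= x * bet & 2 * j.+1%:R <= x * xi /\ 2 <= x * sig].
  have a1 : 0 <= n1%:R :> R by rewrite ler0n.
  have a2 : 0 <= (f + 3 + 4 * K%:R) / kap by rewrite divr_ge0 ?(ltW kap0) //; lra.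
  have a3 : 0 <= 4 * j.+1%:R / bet by rewrite divr_ge0 ?(ltW bet0) //; lra.
  have a4 : 0 <= 2 * j.+1%:R / xi by rewrite divr_ge0 ?(ltW xi0) //; lra.
  have a5 : 0 <= 2 / sig by rewrite divr_ge0 ?(ltW sig0).
  rewrite -!ler_pdivrMr //; move: lt_x a1 a2 a3 a4 a5; rewrite /x0.
  move: (_ / kap) (_ / bet) (_ / xi) (_ / sig) => y1 y2 y3 y4.
  clear; split; [lra | lra | lra | lra | split; lra].
clear lt_x.
have n1V : (n1 <= #|V|)%N by rewrite -(ler_nat R).
have x_gt0 : 0 < x by lra.
have xj i : 0 < x ^+ i by rewrite exprn_gt0.
have {}rob := rob V E mu Ek _ Ech n1V; rewrite (ltW mu0) lmu1 in rob; have {}rob := rob isT.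
clear le_n.
pose m := Num.truncn (kap * x / 2).
have kapx : 0 < kap * x by rewrite mulr_gt0.
have m_le : m%:R <= kap * x / 2 by rewrite truncn_le; lra.
have kapx4 : kap * x <= x / 4 by rewrite mulrC ler_wpM2l ?(ltW x_gt0) //; lra.
(* An arbitrary set of this size is a reservoir for all vertices outside [X] and [D]; nothing random
   is chosen. *)
have [X _ cX] : exists2 X : {set V}, X \subset [set: V] & #|X| = Num.truncn (bet * x).
  apply: subset_of_card; rewrite cardsT -(ler_nat R) -/x.
  have betx : bet * x <= kap * x.
    rewrite ler_wpM2r ?(ltW x_gt0) // /bet ler_pdivrMr; last lra.
    by rewrite ler_peMr ?(ltW kap0) //; lra.
  apply: le_trans (_ : bet * x <= _); last by lra.
  by rewrite truncn_le mulr_ge0 // ltW.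
have betx0 : 0 < bet * x by rewrite mulr_gt0.
have X_le : #|X|%:R <= bet * x by rewrite cX truncn_le ltW.
have X_ge : bet / 2 * x <= #|X|%:R.
  by have := truncnS_gt (bet * x); rewrite -cX -natr1; lra.
have X_ge2 : (2 * j.+1 <= #|X|)%N by rewrite -(ler_nat R) natrM; lra.
have drawsX : 2 * tau * x ^+ j.+1 <= p / 2 * #|draws j X|%:R.
  have : 0 <= bet / 2 * x <= #|X|%:R by rewrite X_ge andbT; lra.
  move/card_draws_ge/(_ X_ge2); rewrite -/c0 exprMn => cd.
  have -> : 2 * tau * x ^+ j.+1 = p / 2 * (c0 * ((bet / 2) ^+ j.+1 * x ^+ j.+1)).
    by rewrite /tau; field.
  by rewrite ler_wpM2l // divr_ge0 // ltW.
pose D := poor E p (draws j X).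
have cD : f * #|D|%:R <= kap * x / 8.
  have cP := card_poor (k := j.+2) isT Ech (@in_draws j V X); rewrite -/D -/x in cP.
  have {}cP : #|D|%:R * (2 * tau) * x ^+ j.+1 <= mu * x * x ^+ j.+1.
    rewrite -[mu * x * _]mulrA -exprS; apply: le_trans cP.
    by rewrite -[X in X <= _]mulrA ler_wpM2l.
  rewrite ler_pM2r // in cP.
  have : mu * x * f <= tau * kap / 4 * x.
    by rewrite mulrAC -mu2f ler_wpM2r ?(ltW x_gt0) // ler_wpM2r // ltW.
  have : #|D|%:R * (2 * tau) * f <= mu * x * f by rewrite ler_wpM2r // ltW.
  move=> h1 h2; have := le_trans h1 h2.
  have -> : #|D|%:R * (2 * tau) * f = f * #|D|%:R * (2 * tau) by ring.
  have -> : tau * kap / 4 * x = kap * x / 8 * (2 * tau) by field.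
  by rewrite ler_pM2r // mulr_gt0.
apply: (@tiled_of_reservoir W V EF E f0 m _ _ _ (Num.truncn (tau * x)) (Num.truncn (xi * x)) X D).
- by rewrite -(ltr_nat R) -/x; lra.
- move=> v U leU vU.
  apply: (cover_avoiding Ek deg rob) => //.
  have : #|U|%:R <= m%:R :> R by rewrite ler_nat.
  rewrite natrD -/x.
  have : gam * x <= kap / 2 * x by rewrite ler_wpM2r // ltW.
  have : kap * x <= al / 4 * x by rewrite ler_wpM2r // ltW.
  lra.
- move=> u v U neq_uv leU.
  have leUm : #|U|%:R <= m%:R :> R by rewrite ler_nat.
  have poor_le w : #|poor E p (link E w)|%:R <= x / 8.
    have := card_poor_link (R := R) x_gt0 p0 Ek Ech deg w; rewrite -/x => h.
    have : mu * x <= kap / 4 * x by rewrite ler_wpM2r // ltW.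
    move/(le_trans h).
    have -> : p / 2 * al = 2 * kap by rewrite /kap; field.
    have -> : kap / 4 * x = x / 8 * (2 * kap) by field.
    by rewrite ler_pM2r // mulr_gt0.
  apply: (connect_avoiding f0 p0 Ek deg rob neq_uv).
    rewrite !natrD -/x -/f.
    have -> : p / 2 * al = 2 * kap by rewrite /kap; field.
    have : gam * x <= kap / 2 * x by rewrite ler_wpM2r // ltW.
    lra.
  rewrite -(ltr_nat R) !natrD -/x.
  have := poor_le u; have := poor_le v; lra.
- move=> S'; rewrite -(ler_nat R) => le_S'.
  have lt_S' : xi * x <= #|S'|%:R by apply: le_trans le_S'; rewrite ltW // truncnS_gt.
  have S'2 : (2 * j.+1 <= #|S'|)%N by rewrite -(ler_nat R) natrM; lra.
  have drawsS' : sig * x ^+ j.+1 <= p / 2 * #|draws j S'|%:R.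
    have : 0 <= xi * x <= #|S'|%:R by rewrite lt_S' andbT mulr_ge0 // ltW.
    move/card_draws_ge/(_ S'2); rewrite -/c0 exprMn => cd.
    by rewrite /sig -!mulrA ler_wpM2l ?(ltW p0) // ler_wpM2l ?invr_ge0.
  apply: (copy_in_dense p0 Ech rob).
    have xs : 0 < xi * sig by rewrite mulr_gt0.
    apply: (@lt_le_trans _ _ (xi * x * (sig * x ^+ j.+1))).
      have -> : xi * x * (sig * x ^+ j.+1) = xi * sig * x ^+ j.+2 by rewrite [in RHS]exprS; ring.
      by rewrite ltr_pM2r //; lra.
    by apply: ler_pM => //; apply: mulr_ge0; rewrite ltW.
  apply: le_trans drawsS'; rewrite exprS mulrA ler_wpM2r ?(ltW (xj j)) //.
  have : gam * x <= sig / 2 * x by rewrite ler_wpM2r // ltW.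
  rewrite -/x; lra.
- move=> v Z vX vD ZX leZ.
  apply: (copy_in_reservoir rob vX vD).
  apply: le_trans drawsX; rewrite exprS mulrA ler_wpM2r ?(ltW (xj j)) //.
  have : gam * x <= tau / 2 * x by rewrite ler_wpM2r // ltW.
  have taux : 0 < tau * x by rewrite mulr_gt0.
  have : #|Z|%:R <= tau * x.
    by apply: (@le_trans _ _ (Num.truncn (tau * x))%:R); rewrite ?ler_nat // truncn_le ltW.
  rewrite -/x; lra.
- rewrite -/K /m truncn_ge_nat; last by rewrite divr_ge0 // ltW.
  rewrite natrD !natrM -natr1 -/f.
  have : #|X|%:R * K%:R <= bet * x * K%:R by rewrite ler_wpM2r.
  rewrite mulrAC betK; lra.
- rewrite truncn_ge_nat; last by rewrite mulr_ge0 // ltW.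
  rewrite natrM -/f.
  have : f * (Num.truncn (xi * x))%:R <= f * (xi * x).
    by rewrite ler_wpM2l ?(ltW f_gt0) // truncn_le mulr_ge0 // ltW.
  rewrite mulrA [f * xi]mulrC xif.
  have : 0 < tau * x by rewrite mulr_gt0.
  lra.
- exact: fV.
Qed.

Theorem mainTheorem17 (R : realType) (k : nat) (W : finType)
  (EF : {set {set W}}) :
  (2 <= k)%N -> is_kgraph k EF -> (0 < #|W|)%N ->
  (FACTOR_cherry1 R k EF <-> COVER_cherry1 R k EF).
Proof.
case: k => [|[|j]] // _ _ f0; split.
  exact: factor_implies_cover.
exact: cover_implies_factor.
Qed.
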